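(* Let $k$ be a field of characteristic zero and let $A$ be any one of the Poisson algebras (i)--(vi) described in the context. For any Poisson prime ideal $P$ of $A$, there exist a field extension $K\supseteq k$ and an antisymmetric matrix ${\boldsymbol\mu}\in M_m(k)$, for some $m$, such that $\operatorname{Fract}A/P\cong K_{\boldsymbol\mu}(y_1,\dots,y_m)$ as Poisson algebras. In case $P=0$, one has $K=k$ and $m=\operatorname{tr.deg}_kA$.
   Context: $K_{\boldsymbol\mu}(y_1,\dots,y_m)$ is the rational function field over $K$ with the $K$-linear Poisson bracket $\{y_i,y_j\}=\mu_{ij}y_iy_j$. In each case below, the bracket on generators determines a Poisson bracket on the polynomial algebra (brackets of other pairs follow from antisymmetry). (i) For antisymmetric ${\bold q}=(q_{ij})\in M_n(k)$: $k[x_1,\dots,x_n]$ with $\{x_i,x_j\}=q_{ij}x_ix_j$. (ii) For antisymmetric ${\bold p}=(p_{ij})\in M_n(k)$ and $\lambda\in k$: $k[X_{ij}:1\le i,j\le n]$ with $\{X_{lm},X_{ij}\}=(p_{li}+p_{jm})X_{ij}X_{lm}+\lambda X_{im}X_{lj}$ if $l>i,m>j$; $=(\lambda+p_{li}+p_{jm})X_{ij}X_{lm}$ if $l>i,m\le j$; $=p_{jm}X_{ij}X_{lm}$ if $l=i,m>j$. (iii) For antisymmetric $\Gamma=(\gamma_{ij})\in M_n(k)$ and $P=(p_i),Q=(q_i)\in k^n$ with $p_i\ne q_i$ for all $i$: $k[x_1,y_1,\dots,x_n,y_n]$ with $\{y_i,y_j\}=\gamma_{ij}y_iy_j$ (all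 $i,j$); $\{x_i,y_j\}=(p_j+\gamma_{ji})x_iy_j$ ($i<j$); $\{x_i,y_j\}=(q_j+\gamma_{ji})x_iy_j$ ($i>j$); $\{x_i,x_j\}=(q_i-p_j+\gamma_{ij})x_ix_j$ ($i<j$); $\{x_i,y_i\}=q_ix_iy_i+\sum_{\ell<i}(q_\ell-p_\ell)x_\ell y_\ell$. (iv) For $\Gamma,P,Q$ as in (iii) and $\lambda\in k$: $k[z_0,x_1,y_1,\dots,x_n,y_n]$ with the brackets of (iii) except that $\{x_i,y_i\}=q_ix_iy_i+\sum_{\ell<i}(q_\ell-p_\ell)x_\ell y_\ell+\lambda z_0^2$, together with $\{z_0,x_i\}=-(p_i/2)z_0x_i$ and $\{z_0,y_i\}=(p_i/2)z_0y_i$. (v) $k[y_{ij}:1\le i\le j\le n]$ with $\{y_{ij},y_{lm}\}=(\operatorname{sign}(l-j)+\operatorname{sign}(m-i))y_{il}y_{jm}+(\operatorname{sign}(l-i)+\operatorname{sign}(m-j))y_{im}y_{jl}$ for $i\le j$, $l\le m$, where $y_{ts}=y_{st}$ and $\operatorname{sign}(t)\in\{1,0,-1\}$. (vi) $k[y_{ij}:1\le i<j\le n]$ with $\{y_{ij},y_{lm}\}=(\operatorname{sign}(l-j)+\operatorname{sign}(m-i))y_{il}y_{jm}-(\operatorname{sign}(l-i)+\operatorname{sign}(m-j))y_{im}y_{jl}$ for $i<j$, $l<m$, where $y_{ts}=-y_{st}$ and $y_{ss}=0$. A Poisson prime ideal is a prime ideal $P$ with $\{A,P\}\subseteq P$.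 *)

(* Defs.v *)
From HB Require Import structures.
From mathcomp Require Import all_boot all_order all_algebra.
From mathcomp Require Import generic_quotient ring_quotient fraction.
From mathcomp.multinomials Require Import mpoly.
From Stdlib Require Import ClassicalEpsilon.

Set Implicit Arguments.
Unset Strict Implicit.
Unset Printing Implicit Defensive.

Import GRing.Theory.
Local Open Scope ring_scope.
Local Open Scope quotient_scope.

(* canonical embedding D -> {fraction D} (fraction.v keeps its notation local) *)
Notation "x %:F" := (@FracField.tofrac _ x) : ring_scope.

Section PrimeQuotientDomain.
Variables (R : comNzRingType) (P : prime_idealr R).
Local Notation Q := {ideal_quot P}.

Definition qunit (x : Q) : bool :=
  if excluded_middle_informative (exists y : Q, y * x = 1) then true else false.

Definition qinv (x : Q) : Q :=
  match excluded_middle_informative (exists y : Q, y * x = 1) with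
  | left H => proj1_sig (constructive_indefinite_description _ H)
  | right _ => x
  end.

Lemma qmulVx : {in qunit, left_inverse 1 qinv *%R}.
Proof.
move=> x; rewrite /qunit /qinv unfold_in /=.
case: excluded_middle_informative => // H _.
by case: constructive_indefinite_description.
Qed.

Lemma qunitPl (x y : Q) : y * x = 1 -> qunit x.
Proof.
move=> yx; rewrite /qunit; case: excluded_middle_informative => // [[]].
by exists y.
Qed.

Lemma qinvr_out : {in [predC qunit], qinv =1 id}.
Proof.
move=> x; rewrite inE /= /qunit /qinv unfold_in /=.
by case: excluded_middle_informative.
Qed.

HB.instance Definition _ :=
  GRing.ComNzRing_hasMulInverse.Build Q qmulVx qunitPl qinvr_out.

HB.instance Definition _ :=
  GRing.ComUnitRing_isIntegral.Build Q (@Quotient.rquot_IdomainAxiom R P).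

End PrimeQuotientDomain.

(* The biderivation of R[x_0..x_{N-1}] with prescribed values B i j on *)
(* the pairs of generators: {f,g} = sum_{i,j} d_i f * d_j g * {x_i,x_j}. *)
Definition pbr (R : comNzRingType) (N : nat)
    (B : 'I_N -> 'I_N -> {mpoly R[N]}) (f g : {mpoly R[N]}) : {mpoly R[N]} :=
  \sum_(i < N) \sum_(j < N) mderiv i f * mderiv j g * B i j.

Definition poisson_ideal (R : nzRingType) (br : R -> R -> R) (P : {pred R}) :=
  forall a u, u \in P -> br a u \in P.

(* Induced bracket on A/P (well defined when P is a Poisson ideal). *)
Definition qbr (R : comNzRingType) (P : prime_idealr R) (br : R -> R -> R)
    (x y : {ideal_quot P}) : {ideal_quot P} :=
  \pi_({ideal_quot P}) (br (repr x) (repr y)).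

(* Induced bracket on the fraction field: the quotient-rule formula   *)
(* {a/b, c/d} = ({a,c}bd - {a,d}bc - {b,c}ad + {b,d}ac) / (b^2 d^2).   *)
Definition fbr (D : idomainType) (br : D -> D -> D) (x y : {fraction D})
    : {fraction D} :=
  let a := \n_(repr x) in let b := \d_(repr x) in
  let c := \n_(repr y) in let d := \d_(repr y) in
  (br a c * b * d - br a d * b * c - br b c * a * d + br b d * a * c)%:F
    / (b * b * d * d)%:F.

(* K_mu(y_1..y_m): the rational function field K(y_1..y_m) with the     *)
(* K-linear bracket {y_i,y_j} = mu_ij y_i y_j (mu has entries in k,      *)
(* embedded in K through iota).                                         *)
Definition qtorus_gen (k K : fieldType) (iota : k -> K) (m : nat)
    (mu : 'M[k]_m) (i j : 'I_m) : {mpoly K[m]} :=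
  (iota (mu i j))%:MP * 'X_i * 'X_j.

Definition qtorus_br (k K : fieldType) (iota : k -> K) (m : nat)
    (mu : 'M[k]_m) : {fraction {mpoly K[m]}} -> {fraction {mpoly K[m]}} ->
    {fraction {mpoly K[m]}} :=
  fbr (pbr (qtorus_gen iota mu)).

Definition poisson_kiso (k F1 F2 : fieldType) (e1 : k -> F1) (e2 : k -> F2)
    (b1 : F1 -> F1 -> F1) (b2 : F2 -> F2 -> F2) (f : F1 -> F2) : Prop :=
  [/\ bijective f,
      (forall x y, f (x + y) = f x + f y),
      (forall x y, f (x * y) = f x * f y) /\ f 1 = 1,
      (forall c, f (e1 c) = e2 c) &
      (forall x y, f (b1 x y) = b2 (f x) (f y))].

(* The Poisson algebras (i)-(vi).  Variables are indexed by a finite   *)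
(* type I, the i-th variable being 'X_(enum_rank a) in k[#|I|].        *)
Section Families.
Variable k : fieldType.

Definition Xg (I : finType) (a : I) : {mpoly k[#|I|]} := 'X_(enum_rank a).

Definition liftB (I : finType) (Bg : I -> I -> {mpoly k[#|I|]})
    : 'I_#|I| -> 'I_#|I| -> {mpoly k[#|I|]} :=
  fun a b => Bg (enum_val a) (enum_val b).

Definition B_i (n : nat) (q : 'M[k]_n) (a b : 'I_n) : {mpoly k[#|'I_n|]} :=
  (q a b)%:MP * Xg a * Xg b.

Definition lexgt (n : nat) (u v : 'I_n * 'I_n) : bool :=
  (v.1 < u.1)%N || ((u.1 == v.1) && (v.2 < u.2)%N).

Definition B_ii_core (n : nat) (p : 'M[k]_n) (lam : k) (u v : 'I_n * 'I_n)
    : {mpoly k[#|{: 'I_n * 'I_n}|]} :=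
  let: (l, m) := u in let: (i, j) := v in
  if (i < l)%N then
    (if (j < m)%N then
       (p l i + p j m)%:MP * Xg (i, j) * Xg (l, m) + lam%:MP * Xg (i, m) * Xg (l, j)
     else (lam + p l i + p j m)%:MP * Xg (i, j) * Xg (l, m))
  else (p j m)%:MP * Xg (i, j) * Xg (l, m).

Definition B_ii (n : nat) (p : 'M[k]_n) (lam : k) (u v : 'I_n * 'I_n)
    : {mpoly k[#|{: 'I_n * 'I_n}|]} :=
  if lexgt u v then B_ii_core p lam u v
  else if lexgt v u then - B_ii_core p lam v u else 0.

(* (iii)/(iv): brackets among x_i, y_j, given the embeddings xv, yv of  *)
(* the variables and the extra term E added to {x_i, y_i}.              *)
Section Weyl.
Variables (N n : nat) (G : 'M[k]_n) (P Q : 'I_n -> k).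
Variables (xv yv : 'I_n -> {mpoly k[N]}) (E : {mpoly k[N]}).

Definition br_xy (i j : 'I_n) : {mpoly k[N]} :=
  if (i < j)%N then (P j + G j i)%:MP * xv i * yv j
  else if (j < i)%N then (Q j + G j i)%:MP * xv i * yv j
  else (Q i)%:MP * xv i * yv i
       + \sum_(l < n | (l < i)%N) (Q l - P l)%:MP * xv l * yv l + E.

Definition br_xx (i j : 'I_n) : {mpoly k[N]} :=
  if (i < j)%N then (Q i - P j + G i j)%:MP * xv i * xv j
  else if (j < i)%N then - ((Q j - P i + G j i)%:MP * xv j * xv i)
  else 0.

Definition br_yy (i j : 'I_n) : {mpoly k[N]} := (G i j)%:MP * yv i * yv j.

Definition B_weyl (u v : 'I_n + 'I_n) : {mpoly k[N]} :=
  match u, v with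
  | inl i, inl j => br_xx i j
  | inl i, inr j => br_xy i j
  | inr j, inl i => - br_xy i j
  | inr i, inr j => br_yy i j
  end.
End Weyl.

Definition B_iii (n : nat) (G : 'M[k]_n) (P Q : 'I_n -> k) (u v : 'I_n + 'I_n)
    : {mpoly k[#|{: 'I_n + 'I_n}|]} :=
  B_weyl G P Q (fun i => Xg (inl i : 'I_n + 'I_n))
    (fun i => Xg (inr i : 'I_n + 'I_n)) 0 u v.

Definition B_iv (n : nat) (G : 'M[k]_n) (P Q : 'I_n -> k) (lam : k)
    (u v : option ('I_n + 'I_n)) : {mpoly k[#|{: option ('I_n + 'I_n)}|]} :=
  let z := Xg (None : option ('I_n + 'I_n)) in
  let xv := fun i => Xg (Some (inl i) : option ('I_n + 'I_n)) in
  let yv := fun i => Xg (Some (inr i) : option ('I_n + 'I_n)) in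
  match u, v with
  | None, None => 0
  | None, Some (inl i) => - (P i / 2%:R)%:MP * z * xv i
  | None, Some (inr i) => (P i / 2%:R)%:MP * z * yv i
  | Some (inl i), None => (P i / 2%:R)%:MP * z * xv i
  | Some (inr i), None => - ((P i / 2%:R)%:MP * z * yv i)
  | Some a, Some b => B_weyl G P Q xv yv (lam%:MP * z * z) a b
  end.

Definition sgnk (n : nat) (a b : 'I_n) : k :=
  if (b < a)%N then 1 else if a == b then 0 else -1.

Definition Isym (n : nat) := {p : 'I_n * 'I_n | (p.1 <= p.2)%N}.

Definition yo_sym (n : nat) (p : 'I_n * 'I_n) : {mpoly k[#|{: Isym n}|]} :=
  odflt 0 (omap (@Xg (Isym n)) (insub p)).

Definition ysym (n : nat) (i j : 'I_n) : {mpoly k[#|{: Isym n}|]} :=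
  if (i <= j)%N then yo_sym (i, j) else yo_sym (j, i).

Definition B_v (n : nat) (u v : Isym n) : {mpoly k[#|{: Isym n}|]} :=
  let: (i, j) := val u in let: (l, m) := val v in
  (sgnk l j + sgnk m i)%:MP * ysym i l * ysym j m
  + (sgnk l i + sgnk m j)%:MP * ysym i m * ysym j l.

Definition Iasym (n : nat) := {p : 'I_n * 'I_n | (p.1 < p.2)%N}.

Definition yo_asym (n : nat) (p : 'I_n * 'I_n) : {mpoly k[#|{: Iasym n}|]} :=
  odflt 0 (omap (@Xg (Iasym n)) (insub p)).

Definition yasym (n : nat) (i j : 'I_n) : {mpoly k[#|{: Iasym n}|]} :=
  if (i < j)%N then yo_asym (i, j)
  else if (j < i)%N then - yo_asym (j, i) else 0.

Definition B_vi (n : nat) (u v : Iasym n) : {mpoly k[#|{: Iasym n}|]} :=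
  let: (i, j) := val u in let: (l, m) := val v in
  (sgnk l j + sgnk m i)%:MP * yasym i l * yasym j m
  - (sgnk l i + sgnk m j)%:MP * yasym i m * yasym j l.

Inductive poisson_example : forall N : nat,
    ('I_N -> 'I_N -> {mpoly k[N]}) -> Prop :=
| PE_i (n : nat) (q : 'M[k]_n) :
    q^T = - q -> poisson_example (liftB (B_i q))
| PE_ii (n : nat) (p : 'M[k]_n) (lam : k) :
    p^T = - p -> poisson_example (liftB (B_ii p lam))
| PE_iii (n : nat) (G : 'M[k]_n) (P Q : 'I_n -> k) :
    G^T = - G -> (forall i, P i != Q i) -> poisson_example (liftB (B_iii G P Q))
| PE_iv (n : nat) (G : 'M[k]_n) (P Q : 'I_n -> k) (lam : k) :
    G^T = - G -> (forall i, P i != Q i) ->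
    poisson_example (liftB (B_iv G P Q lam))
| PE_v (n : nat) : poisson_example (liftB (@B_v n))
| PE_vi (n : nat) : poisson_example (liftB (@B_vi n)).

End Families.

Definition frac_quot_emb (k : fieldType) (N : nat)
    (P : prime_idealr {mpoly k[N]}) (c : k) : {fraction {ideal_quot P}} :=
  (\pi_({ideal_quot P}) (c%:MP))%:F.

(* Main.v *)
(* Every algebra in the list is an iterated Poisson-Ore extension: in a suitable
   order of the variables, {x_j, b} = alpha_j(b) x_j + delta_j(b) for b in the
   earlier variables, with alpha_j diagonal, delta_j locally nilpotent and
   alpha_j delta_j = delta_j (alpha_j + s_j), where s_j <> 0 unless delta_j = 0.
   In F = Fract A/P, if x_j and s_j are nonzero, b |-> exp(-(s_j x_j)^-1 delta_j)(b)
   preserves the brackets of the earlier variables and satisfies the bracket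
   relation with x_j in which delta_j is removed.  Preservation of brackets is
   seen by replacing x_j^-1 by an indeterminate and comparing two solutions of
   the differential equation L' = c delta_j L with the same constant term.  If
   x_j = 0 in F there is nothing to do.  Running j downwards yields generators
   z_i of the field F with {z_i, z_j} = mu_ij z_i z_j.

   Let K be the Poisson centre of F.  Dropping central generators, and applying
   Euclid's algorithm to the exponent vector of any central monomial, one may
   assume that no nontrivial monomial in the z_i is central; distinct monomials
   then have distinct weights under the derivations z_b^-1 {z_b, -}, so the z_i
   are algebraically independent over K.  When P = 0 the N generators z_i of F
   are algebraically independent over k because their Jacobian matrix with
   respect to x_1, ..., x_N is invertible. *)

Require Import Defs.
From HB Require Import structures.
From mathcomp Require Import all_boot all_order all_algebra.
From mathcomp Require Import generic_quotient ring_quotient fraction.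
From mathcomp.multinomials Require Import mpoly.
From mathcomp Require Import ring zify.
From Stdlib Require Import ClassicalEpsilon.

Set Implicit Arguments.
Unset Strict Implicit.
Unset Printing Implicit Defensive.

Import GRing.Theory.
Local Open Scope ring_scope.

(** * Derivations and Poisson brackets *)

(** The exponential is handled outside F. After some deletions nothing is known about the relations
    among the current generators of F, so delta_j is not known to descend to the algebra that they
    generate. All identities are therefore proved in A[X], with A the original polynomial ring and X
    in place of x_j^-1, and only evaluated in F afterwards; a stage of the algorithm records values
    of brackets and generation, never independence. The price is that evaluation at x_j^-1 does not
    carry the X-linear extension of the bracket of A to the bracket of F: a correction term
    proportional to X appears, and it has to satisfy the same differential equation. The entries of
    mu stay in k because the alpha_l act diagonally with weights in k. Deleting delta_j does not
    disturb the relation of an earlier treated x_l with the lower generators: each application of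
    delta_j raises the alpha_l-weight by that of x_j, and the accompanying factor x_j^-1 lowers it
    by the same amount. *)

Definition derivation_along (R S : comNzRingType) (phi d : R -> S) : Prop :=
  (forall a b, d (a + b) = d a + d b) /\
  (forall a b, d (a * b) = d a * phi b + phi a * d b).

Section DerivationAlong.
Variables (R S : comNzRingType) (phi : {rmorphism R -> S}) (d : R -> S).
Hypothesis dP : derivation_along phi d.

Lemma drv0 : d 0 = 0.
Proof. by apply: (addrI (d 0)); rewrite -dP.1 !addr0. Qed.

Lemma drvN a : d (- a) = - d a.
Proof. by apply: (addrI (d a)); rewrite -dP.1 !subrr drv0. Qed.

Lemma drvB a b : d (a - b) = d a - d b.
Proof. by rewrite dP.1 drvN. Qed.

Lemma drv1 : d 1 = 0.
Proof.
apply: (addrI (d 1)); rewrite addr0 -{3}(mulr1 1) dP.2.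
by rewrite rmorph1 mulr1 mul1r.
Qed.

Lemma drv_sum I (r : seq I) (Q : pred I) G :
  d (\sum_(i <- r | Q i) G i) = \sum_(i <- r | Q i) d (G i).
Proof. by apply: (big_morph d dP.1 drv0). Qed.

End DerivationAlong.

Lemma mderivXU (k : comNzRingType) (n : nat) (i j : 'I_n) :
  mderiv i ('X_j : {mpoly k[n]}) = (i == j)%:R.
Proof.
rewrite mderivX mnm1E eq_sym; case: eqP => [->|_]; last by rewrite scale0r.
by rewrite scale1r -mpolyX0; congr 'X_[_]; apply/mnmP=> l; rewrite mnmBE mnm0E subnn.
Qed.

Section ChainRule.
Variables (k : comNzRingType) (n : nat) (S : comNzRingType).
Variables (phi : {rmorphism {mpoly k[n]} -> S}).

Lemma mpoly_alg_ind (T : {mpoly k[n]} -> Prop) :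
  (forall c, T c%:MP) -> (forall i, T 'X_i) ->
  (forall p q, T p -> T q -> T (p + q)) ->
  (forall p q, T p -> T q -> T (p * q)) -> forall p, T p.
Proof.
move=> TC TX TD TM p; elim/mpolyind: p => [|c m p _ _ IH].
  by rewrite -mpolyC0; apply: TC.
apply: (TD) => //; rewrite -mul_mpolyC; apply: (TM); first exact: TC.
rewrite mpolyXE_id; apply: (big_ind T); [by rewrite -mpolyC1; apply: TC | exact: TM |].
move=> i _; elim: (m i) => [|e IHe]; first by rewrite expr0 -mpolyC1; apply: TC.
by rewrite exprS; apply: TM.
Qed.

(** Serves mostly as a uniqueness principle: derivations along [phi] that kill the constants and
    agree on the variables coincide. *)
Lemma derivation_chain (d : {mpoly k[n]} -> S) :
  derivation_along phi d -> (forall c, d c%:MP = 0) ->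
  forall f, d f = \sum_(i < n) phi (mderiv i f) * d 'X_i.
Proof.
move=> dP d0; elim/mpoly_alg_ind => [c|i|p q IHp IHq|p q IHp IHq].
- by rewrite d0 big1 // => i _; rewrite mderivC rmorph0 mul0r.
- rewrite (bigD1 i) //= mderivXU eqxx rmorph1 mul1r big1 ?addr0 // => j ji.
  by rewrite mderivXU (negPf ji) rmorph0 mul0r.
- rewrite dP.1 IHp IHq -big_split; apply: eq_bigr => i _ /=.
  by rewrite mderivD rmorphD mulrDl.
- rewrite dP.2 IHp IHq mulr_suml mulr_sumr -big_split; apply: eq_bigr => i _ /=.
  by rewrite mderivM rmorphD !rmorphM; ring.
Qed.

End ChainRule.

Section Der.
Variables (k : comNzRingType) (n : nat).
Local Notation A := {mpoly k[n]}.
Implicit Types (v : 'I_n -> A) (f g : A).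

Definition der v f : A := \sum_(i < n) mderiv i f * v i.

Lemma derX v i : der v 'X_i = v i.
Proof.
rewrite /der (bigD1 i) //= mderivXU eqxx mul1r big1 ?addr0 // => j ji.
by rewrite mderivXU (negPf ji) mul0r.
Qed.

Lemma derC v c : der v c%:MP = 0.
Proof. by rewrite /der big1 // => i _; rewrite mderivC mul0r. Qed.

Lemma derD v f g : der v (f + g) = der v f + der v g.
Proof. by rewrite -big_split; apply: eq_bigr => i _; rewrite mderivD mulrDl. Qed.

Lemma derM v f g : der v (f * g) = der v f * g + f * der v g.
Proof.
rewrite /der mulr_suml mulr_sumr -big_split; apply: eq_bigr => i _ /=.
by rewrite mderivM; ring.
Qed.

Lemma der_along v : derivation_along idfun (der v).
Proof. by split=> *; rewrite ?derD ?derM. Qed.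

Lemma derN v f : der v (- f) = - der v f.
Proof. exact: (drvN (der_along v)). Qed.

Lemma derB v f g : der v (f - g) = der v f - der v g.
Proof. exact: (drvB (der_along v)). Qed.

Lemma der0 v : der v 0 = 0.
Proof. exact: (drv0 (der_along v)). Qed.

Lemma der_sum v I (r : seq I) (Q : pred I) G :
  der v (\sum_(i <- r | Q i) G i) = \sum_(i <- r | Q i) der v (G i).
Proof. exact: (drv_sum (der_along v)). Qed.

Lemma derCM v c f : der v (c%:MP * f) = c%:MP * der v f.
Proof. by rewrite derM derC mul0r add0r. Qed.

Lemma eq_der v v' f : v =1 v' -> der v f = der v' f.
Proof. by move=> e; apply: eq_bigr => i _; rewrite e. Qed.

Lemma pbrE (B : 'I_n -> 'I_n -> A) f g :
  pbr B f g = der (fun i => der (B i) g) f.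
Proof.
rewrite /pbr /der; apply: eq_bigr => i _; rewrite mulr_sumr.
by apply: eq_bigr => j _; rewrite mulrA.
Qed.

Lemma pbr_flip (B : 'I_n -> 'I_n -> A) f g :
  (forall i j, B i j = - B j i) -> pbr B f g = - pbr B g f.
Proof.
move=> BN; rewrite /pbr exchange_big -sumrN; apply: eq_bigr => i _.
by rewrite -sumrN; apply: eq_bigr => j _; rewrite BN; ring.
Qed.

End Der.

Section PoissonField.
Variables (F : comNzRingType) (br : F -> F -> F).

(** An antisymmetric biderivation. Jacobi's identity enters through [po_jacobi], as an identity
    between polynomials. *)
Record poisson_bracket : Prop := PoissonBracket {
  brDl : forall x y z, br (x + y) z = br x z + br y z;
  brMl : forall x y z, br (x * y) z = br x z * y + x * br y z;
  brC : forall x y, br x y = - br y x }.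

Hypothesis brP : poisson_bracket.

Lemma br_along_l z : derivation_along idfun (br^~ z).
Proof. by split=> a b /=; [apply: brDl | apply: brMl]. Qed.

Lemma br_along_r z : derivation_along idfun (br z).
Proof.
split=> a b /=; rewrite (brC brP z) ?(brDl brP) ?(brMl brP).
  by rewrite opprD -!(brC brP z).
by rewrite opprD (brC brP z a) (brC brP z b) mulNr mulrN.
Qed.

Lemma brDr z x y : br z (x + y) = br z x + br z y.
Proof. by rewrite (br_along_r z).1. Qed.

Lemma brMr z x y : br z (x * y) = br z x * y + x * br z y.
Proof. by rewrite (br_along_r z).2. Qed.

Lemma br0l z : br 0 z = 0.
Proof. exact: (drv0 (br_along_l z)). Qed.

Lemma br0r z : br z 0 = 0.
Proof. exact: (drv0 (br_along_r z)). Qed.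

Lemma br1r z : br z 1 = 0.
Proof. exact: (drv1 (br_along_r z)). Qed.

End PoissonField.

Lemma derivation_inv (F : fieldType) (d : F -> F) x :
  derivation_along idfun d -> d x^-1 = - (d x * x^-2).
Proof.
move=> dP; have [->|x0] := eqVneq x 0.
  by rewrite invr0 (drv0 dP) mul0r oppr0.
apply: (mulfI x0); apply: (addrI (d x * x^-1)).
rewrite -dP.2 divff // (drv1 (phi := idfun) dP).
by field.
Qed.

Section Generation.
Variables (k F : fieldType) (e : k -> F).

(** Phrased as an induction principle over F. Differences are covered because [e] is a ring morphism
    in every use, so that [e (-1)] is a scalar. *)
Definition generates (I : Type) (y : I -> F) : Prop :=
  forall S : F -> Prop,
    (forall c, S (e c)) -> (forall x z, S x -> S z -> S (x + z)) ->
    (forall x z, S x -> S z -> S (x * z)) -> (forall x, S x -> S x^-1) ->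
    (forall i, S (y i)) -> forall x, S x.

End Generation.

(** * Exponentials of locally nilpotent derivations *)

Section PolyOverMpoly.
Variables (k : comNzRingType) (n : nat).
Local Notation A := {mpoly k[n]}.
Implicit Types (f g : {poly A}) (v : 'I_n -> {poly A}).

Definition pd (u : 'I_n) f : {poly A} := map_poly (mderiv u) f.

Lemma coef_pd u f i : (pd u f)`_i = mderiv u f`_i.
Proof. by rewrite coef_map_id0 // mderiv0. Qed.

Lemma pdD u f g : pd u (f + g) = pd u f + pd u g.
Proof. by apply/polyP=> i; rewrite coefD !coef_pd coefD mderivD. Qed.

Lemma pdM u f g : pd u (f * g) = pd u f * g + f * pd u g.
Proof.
apply/polyP=> i; rewrite coefD coef_pd !coefM raddf_sum -big_split.
by apply: eq_bigr => j _ /=; rewrite !coef_pd mderivM.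
Qed.

Lemma pdC u (c : A) : pd u c%:P = (mderiv u c)%:P.
Proof. exact: map_polyC. Qed.

Lemma pd_comm u w f : pd u (pd w f) = pd w (pd u f).
Proof. by apply/polyP=> i; rewrite !coef_pd mderiv_comm. Qed.

Lemma pd_deriv u f : pd u f^`() = (pd u f)^`().
Proof. by apply/polyP=> i; rewrite coef_pd !coef_deriv coef_pd mderivMn. Qed.

(** A derivation of A[X] for which the indeterminate is a constant. *)
Definition pder v f : {poly A} := \sum_(u < n) pd u f * v u.

Lemma pder_along v : derivation_along idfun (pder v).
Proof.
split=> a b /=; rewrite /pder.
  by rewrite -big_split; apply: eq_bigr => i _; rewrite pdD mulrDl.
rewrite mulr_suml mulr_sumr -big_split; apply: eq_bigr => i _ /=.
by rewrite pdM; ring.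
Qed.

Lemma coef_pderC (v : 'I_n -> A) f i :
  (pder (fun u => (v u)%:P) f)`_i = der v f`_i.
Proof.
by rewrite coef_sum; apply: eq_bigr => u _; rewrite coefMC coef_pd.
Qed.

Lemma pderC_C (v : 'I_n -> A) (b : A) : pder (fun u => (v u)%:P) b%:P = (der v b)%:P.
Proof.
by rewrite /pder /der raddf_sum; apply: eq_bigr => u _; rewrite pdC -polyCM.
Qed.

Lemma pder_deriv (v : 'I_n -> A) f :
  (pder (fun u => (v u)%:P) f)^`() = pder (fun u => (v u)%:P) f^`().
Proof.
apply/polyP=> i; rewrite coef_deriv !coef_pderC coef_deriv.
by rewrite -mulr_natr -[in RHS]mulr_natr derM -mpolyC_nat derC mulr0 addr0.
Qed.

Section Evaluation.
Variables (F : fieldType) (phi : {rmorphism A -> F}) (t : F).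

(** The indeterminate stands for the inverse of the generator being treated: [t] will be
    [(y j)^-1]. *)
Definition evp : {poly A} -> F := horner_eval t \o map_poly phi.

HB.instance Definition _ := GRing.RMorphism.copy evp (horner_eval t \o map_poly phi).

Lemma evpC b : evp b%:P = phi b.
Proof. by rewrite /evp /= map_polyC /horner_eval hornerC. Qed.

Lemma evpX : evp 'X = t.
Proof. by rewrite /evp /= map_polyX /horner_eval hornerX. Qed.

Lemma evp_chain (D : F -> F) :
  derivation_along idfun D -> (forall c, D (phi c%:MP) = 0) -> forall f,
  D (evp f) = \sum_(u < n) evp (pd u f) * D (phi 'X_u) + evp f^`() * D t.
Proof.
move=> DP D0; elim/poly_ind => [|f c IH].
  rewrite !rmorph0 (drv0 DP) big1 ?derivC ?rmorph0 ?mul0r ?addr0 // => u _.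
  by rewrite -polyC0 pdC mderiv0 polyC0 rmorph0 mul0r.
have Dphi : D (phi c) = \sum_(u < n) phi (mderiv u c) * D (phi 'X_u).
  apply: (derivation_chain (phi := phi) (d := D \o phi)) => //.
  by split=> a b /=; rewrite ?rmorphD ?rmorphM ?DP.1 ?DP.2.
rewrite rmorphD rmorphM /= evpC evpX DP.1 DP.2 IH Dphi /=.
rewrite derivD derivM derivX derivC addr0 mulr1 !rmorphD !rmorphM /= evpX.
have -> : \sum_(u < n) evp (pd u (f * 'X + c%:P)) * D (phi 'X_u) =
   (\sum_(u < n) evp (pd u f) * D (phi 'X_u)) * t
   + \sum_(u < n) phi (mderiv u c) * D (phi 'X_u).
  rewrite mulr_suml -big_split; apply: eq_bigr => u _ /=.
  have pdX : pd u 'X = 0.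
    by apply/polyP=> i; rewrite coef_pd coefX coef0 -mpolyC_nat mderivC.
  by rewrite pdD pdM pdC pdX mulr0 addr0 rmorphD rmorphM /= evpC evpX; ring.
by ring.
Qed.

End Evaluation.
End PolyOverMpoly.

Section OreData.
Variables (k : fieldType) (N : nat).
Local Notation A := {mpoly k[N]}.
Variables (B : 'I_N -> 'I_N -> A) (r : 'I_N -> nat) (w : 'I_N -> 'I_N -> k).

Definition low_part (j i : 'I_N) : A := B j i - (w j i)%:MP * 'X_j * 'X_i.

Definition ore_delta (j : 'I_N) : A -> A :=
  der (fun i => if (r i < r j)%N then low_part j i else 0).

(** It also acts on x_l itself, with eigenvalue [w l l]. This turns the rule alpha delta = delta
    (alpha + s) into plain homogeneity of the bracket, which is [po_weight]. *)
Definition ore_alpha (l : 'I_N) : A -> A := der (fun i => (w l i)%:MP * 'X_i).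

(* [k[x_1..x_N]] is an iterated Poisson-Ore extension in the order given by *)
(* [r]: [{x_j, b} = alpha_j(b) x_j + delta_j(b)] for [b] in the variables   *)
(* below [x_j].  The diagonal entry [w j j] is the scalar [s_j] with        *)
(* [alpha_j delta_j = delta_j (alpha_j + s_j)].                             *)
Record poisson_ore : Prop := PoissonOre {
  po_inj : injective r;
  po_anti : forall i j, B i j = - B j i;
  po_jacobi : forall a b c,
    der (B a) (B b c) + der (B b) (B c a) + der (B c) (B a b) = 0;
  po_weight : forall l a b, ore_alpha l (B a b) = (w l a + w l b)%:MP * B a b;
  po_indep : forall i j c, (r i < r j)%N -> (r j <= r c)%N ->
    mderiv c (low_part j i) = 0;
  po_nil : forall i j, (r i < r j)%N -> exists m, iter m (ore_delta j) 'X_i = 0;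
  po_shift : forall j,
    w j j != 0 \/ (forall i, (r i < r j)%N -> low_part j i = 0) }.

End OreData.

Section CharZero.
Variables (k : fieldType).
Hypothesis k0 : [pchar k] =i pred0.

Lemma natS_neq0 m : m.+1%:R != 0 :> k.
Proof. by rewrite (pcharf0P k).1. Qed.

Lemma fact_neq0 m : m`!%:R != 0 :> k.
Proof. by rewrite (pcharf0P k).1 // -lt0n fact_gt0. Qed.

Lemma mpoly_mulrnI n m (a b : {mpoly k[n]}) : a *+ m.+1 = b *+ m.+1 -> a = b.
Proof.
by move=> ab; apply: (scalerI (natS_neq0 m)); rewrite !scaler_nat.
Qed.

Section Exponential.
Variables (n : nat) (v : 'I_n -> {mpoly k[n]}) (c : k).
Local Notation A := {mpoly k[n]}.
Local Notation delta := (der v).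
Local Notation pdelta := (pder (fun u => (v u)%:P)).

(** The coefficient of X^m in the equation reads (m+1) f_(m+1) = c delta(f_m), so in characteristic
    zero a solution is determined by its constant term. This is the uniqueness by which polynomials
    are identified below. *)
Lemma exp_ode_coef (f : {poly A}) : f^`() = c%:MP%:P * pdelta f ->
  forall m, f`_m = (c ^+ m / m`!%:R)%:MP * iter m delta f`_0.
Proof.
move=> fE; elim=> [|m IH]; first by rewrite expr0 fact0 divr1 rmorph1 mul1r.
apply: (@mpoly_mulrnI _ m); rewrite -coef_deriv fE coefCM coef_pderC IH derCM /=.
rewrite !mul_mpolyC -[RHS]scaler_nat !scalerA; congr (_ *: _).
by rewrite factS natrM exprS; field; rewrite fact_neq0 nat1r natS_neq0.
Qed.

(** The solution is exp(c X delta)(b), a polynomial in X because [delta] is nilpotent on b. *)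
Lemma exp_ode_exists (b : A) m : iter m delta b = 0 ->
  exists f : {poly A}, f^`() = c%:MP%:P * pdelta f /\ f`_0 = b.
Proof.
move=> b0.
pose g i : A := (c ^+ i / i`!%:R)%:MP * iter i delta b.
have fE i : (\poly_(i < m) g i)`_i = g i.
  rewrite coef_poly; case: ltnP => // mi; rewrite /g -(subnK mi) iterD b0.
  rewrite (_ : iter _ _ 0 = 0) ?mulr0 //; elim: (i - m)%N => //= q ->; exact: der0.
exists (\poly_(i < m) g i); split; last by rewrite fE /g expr0 fact0 divr1 rmorph1 mul1r.
apply/polyP=> i; rewrite coef_deriv coefCM coef_pderC !fE /g derCM /=.
rewrite !mul_mpolyC -[LHS]scaler_nat !scalerA; congr (_ *: _).
by rewrite factS natrM exprS; field; rewrite fact_neq0 nat1r natS_neq0.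
Qed.

End Exponential.
End CharZero.

(** * Deleting derivations *)

Lemma sum2_combine (R : zmodType) n (a b c d : 'I_n -> 'I_n -> R) :
  - (\sum_(u < n) \sum_(v < n) a u v) + \sum_(u < n) \sum_(v < n) b u v
  + \sum_(u < n) \sum_(v < n) c u v - \sum_(u < n) \sum_(v < n) d u v =
  \sum_(u < n) \sum_(v < n) (- a u v + b u v + c u v - d u v).
Proof.
rewrite -!sumrN -!big_split; apply: eq_bigr => u _ /=.
by rewrite -!sumrN -!big_split.
Qed.

(** Here [x] and [y] are partial derivatives along two variables. Either one of them vanishes,
    because its variable is not below x_j, or the Jacobi formula for delta_j of the bracket of the
    two variables is available. *)
Lemma twisted_leibniz_term (R : comPzRingType) (x y s a b x1 x2 y1 y2 : R) :
  [\/ x = 0, y = 0 | s = - a + b + x1 * y2 - x2 * y1] ->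
  x * y * s = - (x * y * a) + x * y * b + x * x1 * (y * y2) - x * x2 * (y * y1).
Proof. by case=> ->; ring. Qed.

Section Deletion.
Variables (k : fieldType) (N : nat).
Hypothesis k0 : [pchar k] =i pred0.
Local Notation A := {mpoly k[N]}.
Variables (B : 'I_N -> 'I_N -> A) (r : 'I_N -> nat) (w : 'I_N -> 'I_N -> k).
Hypothesis oreP : poisson_ore B r w.

Lemma ore_alpha_low l i j :
  ore_alpha w l (low_part B w j i) = (w l j + w l i)%:MP * low_part B w j i.
Proof.
rewrite /low_part /ore_alpha derB -/(ore_alpha _ _ _) (po_weight oreP).
by rewrite !derM !derC !derX; ring.
Qed.

(** A commutator of derivations is a derivation, so the difference [d] of the two sides need only be
    checked on the variables, where it is the homogeneity of [low_part]. *)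
Lemma ore_alpha_delta l j b :
  ore_alpha w l (ore_delta B r w j b) =
  ore_delta B r w j (ore_alpha w l b) + (w l j)%:MP * ore_delta B r w j b.
Proof.
pose d b := ore_alpha w l (ore_delta B r w j b) -
  ore_delta B r w j (ore_alpha w l b) - (w l j)%:MP * ore_delta B r w j b.
suff: d b = 0 by move/eqP; rewrite subr_eq0 subr_eq => /eqP ->; rewrite addrC.
rewrite (derivation_chain (phi := idfun) (d := d)) /d.
- apply: big1 => i _ /=.
  rewrite /ore_delta /ore_alpha !derX; case: ifP => ij.
    rewrite -/(ore_alpha _ _ _) ore_alpha_low derM derC derX ij.
    by ring.
  by rewrite der0 derM derC derX ij; ring.
- split=> x y /=; rewrite /ore_delta /ore_alpha ?derD ?derM ?derD ?derM; ring.
- by move=> c; rewrite /ore_delta /ore_alpha !derC ?der0 mulr0 !subr0.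
Qed.

Lemma ore_alpha_iter l i j m :
  ore_alpha w l (iter m (ore_delta B r w j) 'X_i) =
  (w l i + w l j *+ m)%:MP * iter m (ore_delta B r w j) 'X_i.
Proof.
elim: m => [|m IH] /=; first by rewrite /ore_alpha derX mulr0n addr0.
rewrite ore_alpha_delta IH /ore_delta derCM -mulrDl -rmorphD /=.
by rewrite mulrSr addrA.
Qed.

Lemma iter_delta_indep i j c m : (r i < r j)%N -> (r j <= r c)%N ->
  mderiv c (iter m (ore_delta B r w j) 'X_i) = 0.
Proof.
move=> ij; elim: m c => [|m IH] c jc /=.
  by rewrite mderivXU; case: eqP => // ci; move: ij; rewrite -ci ltnNge jc.
rewrite {1}/ore_delta /der raddf_sum big1 // => u _ /=.
rewrite mderivM mderiv_comm IH // mderiv0 mul0r add0r.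
by case: ifP => uj; rewrite ?(po_indep oreP) ?mderiv0 ?mulr0.
Qed.

Lemma ore_diag i : B i i = 0.
Proof.
apply: (@mpoly_mulrnI _ k0 _ 1); rewrite mul0rn mulr2n.
by rewrite {1}(po_anti oreP) addNr.
Qed.

Lemma ore_indep i i' c : (r i < r c)%N -> (r i' < r c)%N -> mderiv c (B i i') = 0.
Proof.
wlog: i i' / (r i' < r i)%N => [H ic i'c|i'i ic i'c].
  case: (ltngtP (r i) (r i')) => [ii'|i'i|/(po_inj oreP) ->]; last first.
  - by rewrite ore_diag mderiv0.
  - exact: H.
  - by rewrite (po_anti oreP) mderivN H ?oppr0.
have -> : B i i' = low_part B w i i' + (w i i')%:MP * 'X_i * 'X_i'.
  by rewrite /low_part subrK.
rewrite mderivD (po_indep oreP) // ?(ltnW ic) // !mderivM mderivC !mderivXU.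
have /negPf -> : c != i by apply: contraTneq ic => ->; rewrite ltnn.
have /negPf -> : c != i' by apply: contraTneq i'c => ->; rewrite ltnn.
by rewrite !mulr0n !(mul0r, mulr0, addr0).
Qed.

(* Jacobi's identity, sorted by powers of [x_j]. *)
Lemma ore_delta_bracket i i' j : (r i < r j)%N -> (r i' < r j)%N ->
  ore_delta B r w j (B i i') =
  - der (B i') (low_part B w j i) + der (B i) (low_part B w j i')
  + (w j i)%:MP * 'X_i * low_part B w j i'
  - (w j i')%:MP * 'X_i' * low_part B w j i.
Proof.
move=> ij i'j.
(* [B i i'] involves only variables below x_j, so {x_j, -} acts on it as x_j alpha_j + delta_j. *)
have dB : der (B j) (B i i') =
    (w j i + w j i')%:MP * B i i' * 'X_j + ore_delta B r w j (B i i').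
  rewrite -(po_weight oreP) /ore_alpha /ore_delta /der mulr_suml -big_split.
  apply: eq_bigr => u _ /=; case: ltnP => uj; first by rewrite /low_part; ring.
  by rewrite ore_indep ?mul0r ?addr0 // (leq_trans _ uj).
have Bj u : B j u = low_part B w j u + (w j u)%:MP * 'X_j * 'X_u.
  by rewrite /low_part subrK.
have := po_jacobi oreP j i i'.
rewrite dB (po_anti oreP i' j) derN !Bj !derD !derM !derC !derX.
rewrite (po_anti oreP i j) (po_anti oreP i' j) (po_anti oreP i' i) !Bj rmorphD /=.
move=> JE; apply/eqP; rewrite -subr_eq0 -[X in _ == X]JE; apply/eqP.
by ring.
Qed.

Section Step.
Variables (F : fieldType) (br : F -> F -> F) (e : {rmorphism k -> F}).
Hypothesis brP : poisson_bracket br.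
Hypothesis bre : forall c x, br x (e c) = 0.

(** Generators of rank below [t] still obey the original brackets; those of rank at least [t] are
    already log-canonical with everything below them. *)
Definition deletion_stage (t : nat) (y : 'I_N -> F) : Prop :=
  [/\ forall i i', (r i < t)%N -> (r i' < t)%N -> br (y i) (y i') = mmap e y (B i i'),
      forall j i, (t <= r j)%N -> (r i < r j)%N -> br (y j) (y i) = e (w j i) * y j * y i
    & generates e y].

Variables (y : 'I_N -> F) (j : 'I_N).
Hypothesis stY : deletion_stage (r j).+1 y.
Hypotheses (yj0 : y j != 0) (wjj0 : w j j != 0).

(** Forced by the bracket with x_j. If alpha_j(b) = a b, then in {x_j, sum of c_m x_j^-m
    delta_j^m(b)} the terms other than a x_j times the sum cancel exactly when (m+1) s_j c_(m+1) +
    c_m = 0, that is c_m = (-1/s_j)^m / m!. *)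
Local Notation c := (- (w j j)^-1).
Local Notation low u := (r u < r j)%N.
Local Notation p := (fun u => if low u then low_part B w j u else 0).
Local Notation pdelta := (pder (fun u => (p u)%:P)).
Local Notation phi := (mmap e y).
Local Notation ev := (evp (mmap e y) (y j)^-1).

Lemma exp_family : exists f : 'I_N -> {poly A}, forall i,
  (f i)^`() = c%:MP%:P * pdelta (f i) /\ (f i)`_0 = 'X_i.
Proof.
suff /fin_all_exists [f fP] : forall i, exists f : {poly A},
    f^`() = c%:MP%:P * pdelta f /\ f`_0 = 'X_i by exists f.
move=> i; have [m m0] : exists m, iter m (der p) 'X_i = 0.
  case: (ltnP (r i) (r j)) => ij; first exact: (po_nil oreP ij).
  by exists 1%N; rewrite /= derX ltnNge ij.
exact: (exp_ode_exists k0 _ m0).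
Qed.

Variable f : 'I_N -> {poly A}.
Hypothesis fP : forall i, (f i)^`() = c%:MP%:P * pdelta (f i) /\ (f i)`_0 = 'X_i.

Lemma coef_f i m : (f i)`_m = (c ^+ m / m`!%:R)%:MP * iter m (ore_delta B r w j) 'X_i.
Proof. by rewrite (exp_ode_coef k0 (fP i).1) (fP i).2. Qed.

(** The coefficient of X^m has alpha_l-weight [w l i + w l j *+ m], and X d/dX reads off m. *)
Lemma alpha_f l i : pder (fun u => ((w l u)%:MP * 'X_u)%:P) (f i) =
  (w l i)%:MP%:P * f i + (w l j)%:MP%:P * ('X * (f i)^`()).
Proof.
apply/polyP=> m; rewrite coef_pderC coefD !coefCM coefXM coef_deriv coef_f.
rewrite derCM -/(ore_alpha w l) ore_alpha_iter rmorphD /=.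
case: m => [|m] /=; first by rewrite mulr0n; ring.
by rewrite coef_f raddfMn /=; ring.
Qed.

Lemma pd_f u i : low i -> ~~ low u -> pd u (f i) = 0.
Proof.
move=> li; rewrite -leqNgt => lu; apply/polyP=> m.
by rewrite coef_pd coef0 coef_f mderiv_mulC iter_delta_indep // mulr0.
Qed.

Local Notation t := (y j)^-1.

Lemma phiX u : phi 'X_u = y u.
Proof. by rewrite mmapX mmap1U. Qed.

Lemma evD g h : ev (g + h) = ev g + ev h. Proof. exact: rmorphD. Qed.

Lemma evB g h : ev (g - h) = ev g - ev h. Proof. exact: rmorphB. Qed.

Lemma evM g h : ev (g * h) = ev g * ev h. Proof. exact: rmorphM. Qed.

Lemma ev_sum (G : 'I_N -> {poly A}) : ev (\sum_(u < N) G u) = \sum_(u < N) ev (G u).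
Proof. exact: rmorph_sum. Qed.

Lemma evC b : ev b%:P = phi b. Proof. exact: evpC. Qed.

Lemma ev0 : ev 0 = 0. Proof. exact: rmorph0. Qed.

Lemma ev_pder (v : 'I_N -> A) g :
  ev (pder (fun u => (v u)%:P) g) = \sum_(u < N) ev (pd u g) * phi (v u).
Proof. by rewrite rmorph_sum; apply: eq_bigr => u _ /=; rewrite rmorphM /= evpC. Qed.

Lemma br_chain x g :
  br x (ev g) = \sum_(u < N) ev (pd u g) * br x (y u) + ev g^`() * br x t.
Proof.
rewrite (evp_chain _ (br_along_r brP x)) => [|a]; last by rewrite /= mmapC bre.
by congr (_ + _); apply: eq_bigr => u _ /=; rewrite phiX.
Qed.

Lemma br_t x : br x t = - br x (y j) * t ^+ 2.
Proof. by rewrite (derivation_inv _ (br_along_r brP x)) mulNr exprVn. Qed.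

Lemma br_yj_low u : low u ->
  br (y j) (y u) = e (w j u) * y j * y u + phi (low_part B w j u).
Proof.
have [st _ _] := stY => lu; rewrite st // ?(ltnW lu) ?ltnS ?(ltnW lu) //.
by rewrite /low_part rmorphB !rmorphM /= mmapC !phiX addrC subrK.
Qed.

Lemma br_yj_t : br (y j) t = 0.
Proof.
have [st _ _] := stY; rewrite br_t st ?ltnS // ore_diag rmorph0.
by rewrite oppr0 mul0r.
Qed.

Lemma ev_delta_f i : ev (f i)^`() = e c * ev (pdelta (f i)).
Proof. by rewrite (fP i).1 rmorphM /= evpC /= mmapC. Qed.

Lemma ev_alpha_f l i :
  \sum_(u < N) ev (pd u (f i)) * (e (w l u) * y u) =
  e (w l i) * ev (f i) + e (w l j) * (t * ev (f i)^`()).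
Proof.
have := congr1 ev (alpha_f l i); rewrite rmorphD !rmorphM /= !evpC evpX /= !mmapC => <-.
by rewrite ev_pder; apply: eq_bigr => u _; rewrite rmorphM /= mmapC phiX.
Qed.

Lemma ewjj0 : e (w j j) != 0. Proof. by rewrite fmorph_eq0. Qed.

Lemma ec : e c = - (e (w j j))^-1.
Proof. by rewrite rmorphN fmorphV. Qed.

(** The shift of weights under delta_j contributes [w j j] times the derivative of [f i], which
    cancels the contribution of delta_j by the choice of [c]. *)
Lemma br_yj_f i : low i -> br (y j) (ev (f i)) = e (w j i) * y j * ev (f i).
Proof.
move=> li; rewrite br_chain br_yj_t mulr0 addr0.
transitivity (y j * (\sum_(u < N) ev (pd u (f i)) * (e (w j u) * y u))
              + ev (pdelta (f i))).
  rewrite ev_pder mulr_sumr -big_split; apply: eq_bigr => u _ /=.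
  case: (boolP (low u)) => lu; first by rewrite br_yj_low //; ring.
  by rewrite pd_f // ev0 !mul0r mulr0 addr0.
rewrite ev_alpha_f ev_delta_f ec.
by field; rewrite ewjj0 yj0.
Qed.

(** The excess weight m [w l j] of the m-th coefficient is compensated by the bracket of [y l] with
    the m-th power of [(y j)^-1]. *)
Lemma br_yl_f l i : (r j < r l)%N -> low i ->
  br (y l) (ev (f i)) = e (w l i) * y l * ev (f i).
Proof.
have [_ st _] := stY => jl li; rewrite br_chain br_t st //.
transitivity (y l * (\sum_(u < N) ev (pd u (f i)) * (e (w l u) * y u))
   - ev (f i)^`() * (e (w l j) * y l * y j * t ^+ 2)).
  rewrite mulNr mulrN; congr (_ - _); rewrite mulr_sumr.
  apply: eq_bigr => u _; case: (boolP (low u)) => lu.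
    by rewrite st // ?(ltn_trans lu) //; ring.
  by rewrite pd_f // ev0 !mul0r mulr0.
rewrite ev_alpha_f; by field.
Qed.

Definition coef_bracket (g h : {poly A}) : {poly A} :=
  \sum_(u < N) \sum_(v < N) pd u g * pd v h * (B u v)%:P.

(** A polynomial whose value at [(y j)^-1] is the bracket of two deleted generators: the X-linear
    bracket plus the contribution of the brackets with x_j^-1, from which delta_j has dropped
    out. *)
Definition exp_bracket i i' : {poly A} := coef_bracket (f i) (f i') +
  'X * ((w j i)%:MP%:P * f i * (f i')^`() - (w j i')%:MP%:P * (f i)^`() * f i').

Lemma br_f_f i i' : low i -> low i' ->
  br (ev (f i)) (ev (f i')) = ev (exp_bracket i i').
Proof.
have [st _ _] := stY => li li'.
have bt : br (ev (f i)) t = e (w j i) * t * ev (f i).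
  by rewrite br_t (brC brP) br_yj_f //; field.
have by_ v : low v -> br (ev (f i)) (y v) =
    \sum_(u < N) ev (pd u (f i)) * phi (B u v)
    - ev (f i)^`() * (e (w j v) * t * y v + t ^+ 2 * phi (low_part B w j v)).
  move=> lv; rewrite (brC brP) br_chain opprD -sumrN; congr (_ + _).
    apply: eq_bigr => u _; case: (boolP (low u)) => lu.
      rewrite st ?ltnS ?(ltnW lu) ?(ltnW lv) // (po_anti oreP v u) mmapN.
      by rewrite mulrN opprK.
    by rewrite pd_f // ev0 !mul0r oppr0.
  by rewrite br_t (brC brP) br_yj_low //; field.
rewrite br_chain bt.
(* Once [ev_alpha_f] is applied, the terms in t^2 are the derivative of [f i] times [w j j] (f i')'
   + delta_j(f i'), a factor that vanishes because (f i')' = c delta_j(f i'). *)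
transitivity (\sum_(v < N) \sum_(u < N) ev (pd u (f i)) * ev (pd v (f i')) * phi (B u v)
  - ev (f i)^`() * (t * (\sum_(v < N) ev (pd v (f i')) * (e (w j v) * y v))
      + t ^+ 2 * ev (pdelta (f i'))) + ev (f i')^`() * (e (w j i) * t * ev (f i))).
  congr (_ + _); rewrite ev_pder !mulr_sumr -big_split mulr_sumr -sumrB.
  apply: eq_bigr => v _ /=; case: (boolP (low v)) => lv.
    rewrite by_ // mulrBr mulr_sumr; congr (_ - _); last by ring.
    by apply: eq_bigr => u _; ring.
  rewrite pd_f // ev0 !mul0r !mulr0 addr0 mulr0 subr0.
  by rewrite big1 // => u _; rewrite mulr0 mul0r.
have -> : ev (exp_bracket i i') =
  \sum_(u < N) \sum_(v < N) ev (pd u (f i)) * ev (pd v (f i')) * phi (B u v)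
  + t * (e (w j i) * ev (f i) * ev (f i')^`() - e (w j i') * ev (f i)^`() * ev (f i')).
  rewrite evD evM evB !evM !evC !mmapC evpX; congr (_ + _).
  rewrite ev_sum; apply: eq_bigr => u _; rewrite ev_sum; apply: eq_bigr => v _.
  by rewrite !evM evC.
rewrite ev_alpha_f exchange_big.
rewrite !(ev_delta_f i') ec.
by field; rewrite yj0 ewjj0.
Qed.

Lemma pd_pder u g : pd u (pdelta g) =
  pdelta (pd u g) + \sum_(a < N) pd a g * (mderiv u (p a))%:P.
Proof.
rewrite /pder (big_morph (pd u) (pdD u) (_ : pd u 0 = 0)); last first.
  by rewrite -polyC0 pdC mderiv0.
by rewrite -big_split; apply: eq_bigr => a _ /=; rewrite pdM pdC pd_comm.
Qed.

(* [delta_j] fails to be a derivation of the bracket exactly by the twist *)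
(* [alpha g * delta h - delta g * alpha h].                               *)
Lemma pdelta_coef_bracket g h :
  (forall u, ~~ low u -> pd u g = 0) -> (forall u, ~~ low u -> pd u h = 0) ->
  pdelta (coef_bracket g h) = coef_bracket (pdelta g) h + coef_bracket g (pdelta h)
  + pder (fun u => ((w j u)%:MP * 'X_u)%:P) g * pdelta h
  - pdelta g * pder (fun u => ((w j u)%:MP * 'X_u)%:P) h.
Proof.
move=> lg lh.
(* By the Leibniz rule delta_j hits the first factor ([S1]), the second ([S2]) or the structure
   polynomials [B u v] ([S3]). [S4] and [S5] arise from moving partial derivatives past delta_j;
   [T1] and [T2] below are the two halves of the twist. *)
pose S1 := \sum_(u < N) \sum_(v < N) pdelta (pd u g) * pd v h * (B u v)%:P.
pose S2 := \sum_(u < N) \sum_(v < N) pd u g * pdelta (pd v h) * (B u v)%:P.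
pose S3 := \sum_(u < N) \sum_(v < N) pd u g * pd v h * (der p (B u v))%:P.
pose S4 := \sum_(u < N) \sum_(v < N) pd u g * pd v h * (der (B v) (p u))%:P.
pose S5 := \sum_(u < N) \sum_(v < N) pd u g * pd v h * (der (B u) (p v))%:P.
have E1 : coef_bracket (pdelta g) h = S1 - S4.
  transitivity (S1 + \sum_(u < N) \sum_(v < N) \sum_(a < N)
      pd a g * (mderiv u (p a))%:P * pd v h * (B u v)%:P).
    rewrite /S1 -big_split; apply: eq_bigr => u _; rewrite -big_split.
    apply: eq_bigr => v _ /=; rewrite pd_pder !mulrDl; congr (_ + _).
    by rewrite !mulr_suml.
  congr (_ + _); rewrite /S4 -sumrN.
  under eq_bigr => u _ do rewrite exchange_big.
  rewrite exchange_big; apply: eq_bigr => a _ /=.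
  rewrite exchange_big -sumrN; apply: eq_bigr => v _ /=.
  rewrite /der raddf_sum mulr_sumr -sumrN; apply: eq_bigr => u _ /=.
  by rewrite (po_anti oreP u v) polyCM polyCN; ring.
have E2 : coef_bracket g (pdelta h) = S2 + S5.
  transitivity (S2 + \sum_(u < N) \sum_(v < N) \sum_(a < N)
      pd u g * (pd a h * (mderiv v (p a))%:P) * (B u v)%:P).
    rewrite /S2 -big_split; apply: eq_bigr => u _; rewrite -big_split.
    apply: eq_bigr => v _ /=; rewrite pd_pder mulrDr !mulrDl; congr (_ + _).
    by rewrite mulr_sumr !mulr_suml.
  congr (_ + _); apply: eq_bigr => u _; rewrite exchange_big.
  apply: eq_bigr => a _ /=; rewrite /der raddf_sum mulr_sumr.
  by apply: eq_bigr => v _ /=; rewrite polyCM; ring.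
have E0 : pdelta (coef_bracket g h) = S1 + S2 + S3.
  rewrite /coef_bracket (drv_sum (pder_along _)) -!big_split; apply: eq_bigr => u _ /=.
  rewrite (drv_sum (pder_along _)) -!big_split; apply: eq_bigr => v _ /=.
  by rewrite !(pder_along _).2 pderC_C /=; ring.
pose T1 := \sum_(u < N) \sum_(v < N)
  pd u g * ((w j u)%:MP * 'X_u)%:P * (pd v h * (p v)%:P).
pose T2 := \sum_(u < N) \sum_(v < N)
  pd u g * (p u)%:P * (pd v h * ((w j v)%:MP * 'X_v)%:P).
have E3 : pder (fun u => ((w j u)%:MP * 'X_u)%:P) g * pdelta h = T1.
  exact: big_distrlr.
have E4 : pdelta g * pder (fun u => ((w j u)%:MP * 'X_u)%:P) h = T2.
  exact: big_distrlr.
(* The only place where Jacobi's identity is used, term by term through [ore_delta_bracket]. *)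
have E5 : S3 = - S4 + S5 + T1 - T2.
  apply: etrans (esym (sum2_combine _ _ _ _)).
  apply: eq_bigr => u _; apply: eq_bigr => v _; cbv beta.
  apply: twisted_leibniz_term.
  case: (boolP (low u)) => lu; last by constructor 1; rewrite lg.
  case: (boolP (low v)) => lv; last by constructor 2; rewrite lh.
  constructor 3; rewrite -/(ore_delta B r w j (B u v)) ore_delta_bracket //.
  cbv beta.
  move: (low_part B w j u) (low_part B w j v) => pu pv.
  by rewrite polyCB !polyCD polyCN !polyCM; ring.
apply: etrans E0 _; apply: esym.
apply: etrans (_ : _ = S1 - S4 + (S2 + S5) + T1 - T2) _.
  exact: (congr2 (fun x z => x - z) (congr2 +%R (congr2 +%R E1 E2) E3) E4).
by rewrite E5; ring.
Qed.

Lemma deriv_coef_bracket g h : (coef_bracket g h)^`() = coef_bracket g^`() h + coef_bracket g h^`().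
Proof.
rewrite /coef_bracket raddf_sum -big_split; apply: eq_bigr => u _.
rewrite [LHS]raddf_sum -big_split; apply: eq_bigr => v _.
rewrite !pd_deriv [LHS]derivM derivC mulr0 addr0 derivM.
by rewrite mulrDl.
Qed.

Lemma pdCM u (a : k) (g : {poly A}) : pd u (a%:MP%:P * g) = a%:MP%:P * pd u g.
Proof. by rewrite pdM pdC mderivC polyC0 mul0r add0r. Qed.

Lemma coef_bracketCl (a : k) (g h : {poly A}) :
  coef_bracket (a%:MP%:P * g) h = a%:MP%:P * coef_bracket g h.
Proof.
rewrite /coef_bracket mulr_sumr; apply: eq_bigr => u _; rewrite mulr_sumr.
by apply: eq_bigr => v _; rewrite pdCM !mulrA.
Qed.

Lemma coef_bracketCr (a : k) (g h : {poly A}) :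
  coef_bracket g (a%:MP%:P * h) = a%:MP%:P * coef_bracket g h.
Proof.
rewrite /coef_bracket mulr_sumr; apply: eq_bigr => u _; rewrite mulr_sumr.
by apply: eq_bigr => v _; rewrite pdCM mulrCA !mulrA.
Qed.

Lemma pdeltaC (a : k) : pdelta (a%:MP%:P : {poly A}) = 0.
Proof. by rewrite pderC_C derC polyC0. Qed.

Lemma pdeltaX : pdelta 'X = 0.
Proof.
rewrite /pder big1 // => u _; rewrite (_ : pd u 'X = 0) ?mul0r //.
by apply/polyP=> i; rewrite coef_pd coefX coef0 -mpolyC_nat mderivC.
Qed.

Lemma pdeltaCM (a : k) (g : {poly A}) : pdelta (a%:MP%:P * g) = a%:MP%:P * pdelta g.
Proof. by rewrite (pder_along _).2 pdeltaC mul0r add0r. Qed.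

(** The letters [d], [dd] stand for delta f, delta^2 f, and [P1], [P2] for the two coefficient
    brackets. The twist of delta_j on the bracket matches the terms obtained by differentiating the
    factor X, and the two contributions of the weight [s] cancel each other. *)
Lemma exp_bracket_ode_ring (R : comPzRingType) (X c a a' s f0 g0 d d' dd dd' P1 P2 : R) :
  c * P1 + c * P2 + (a * f0 * (c * d') - a' * (c * d) * g0
    + X * ((a * (c * d) * (c * d') + a * f0 * (c * (c * dd')))
           - (a' * (c * (c * dd)) * g0 + a' * (c * d) * (c * d')))) =
  c * (P1 + P2 + (a * f0 + s * (X * (c * d))) * d'
     - d * (a' * g0 + s * (X * (c * d')))
     + X * ((a * d * (c * d') + a * f0 * (c * dd')) -
            (a' * (c * dd) * g0 + a' * (c * d) * d'))).
Proof. by ring. Qed.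

Lemma exp_bracket_ode i i' : low i -> low i' ->
  (exp_bracket i i')^`() = c%:MP%:P * pdelta (exp_bracket i i').
Proof.
move=> li li'.
have f2 a : (f a)^`()^`() = c%:MP%:P * (c%:MP%:P * pdelta (pdelta (f a))).
  rewrite {1}(fP a).1 derivM derivC mul0r add0r pder_deriv (fP a).1.
  by rewrite pdeltaCM.
have dR : pdelta (exp_bracket i i') =
   coef_bracket (pdelta (f i)) (f i') + coef_bracket (f i) (pdelta (f i'))
   + ((w j i)%:MP%:P * f i + (w j j)%:MP%:P * ('X * (c%:MP%:P * pdelta (f i))))
     * pdelta (f i')
   - pdelta (f i) * ((w j i')%:MP%:P * f i'
        + (w j j)%:MP%:P * ('X * (c%:MP%:P * pdelta (f i'))))
   + 'X * (((w j i)%:MP%:P * pdelta (f i) * (c%:MP%:P * pdelta (f i'))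
            + (w j i)%:MP%:P * f i * (c%:MP%:P * pdelta (pdelta (f i'))))
         - ((w j i')%:MP%:P * (c%:MP%:P * pdelta (pdelta (f i))) * f i'
            + (w j i')%:MP%:P * (c%:MP%:P * pdelta (f i)) * pdelta (f i'))).
  rewrite (pder_along _).1; congr (_ + _).
    have lf a : low a -> forall u, ~~ low u -> pd u (f a) = 0.
      by move=> la u; apply: pd_f.
    by rewrite (pdelta_coef_bracket (lf _ li) (lf _ li')) !alpha_f !(fP _).1.
  rewrite (pder_along _).2 pdeltaX mul0r add0r; congr (_ * _).
  rewrite (drvB (pder_along _)) !(fP _).1; congr (_ - _).
    by rewrite (pder_along _).2 !pdeltaCM.
  by rewrite (pder_along _).2 !pdeltaCM.
have -> : (exp_bracket i i')^`() =
   c%:MP%:P * coef_bracket (pdelta (f i)) (f i') + c%:MP%:P * coef_bracket (f i) (pdelta (f i'))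
   + ((w j i)%:MP%:P * f i * (c%:MP%:P * pdelta (f i'))
      - (w j i')%:MP%:P * (c%:MP%:P * pdelta (f i)) * f i'
   + 'X * (((w j i)%:MP%:P * (c%:MP%:P * pdelta (f i)) * (c%:MP%:P * pdelta (f i'))
           + (w j i)%:MP%:P * f i * (c%:MP%:P * (c%:MP%:P * pdelta (pdelta (f i')))))
         - ((w j i')%:MP%:P * (c%:MP%:P * (c%:MP%:P * pdelta (pdelta (f i)))) * f i'
            + (w j i')%:MP%:P * (c%:MP%:P * pdelta (f i)) * (c%:MP%:P * pdelta (f i'))))).
  rewrite /exp_bracket derivD deriv_coef_bracket; congr (_ + _).
    by rewrite !(fP _).1 coef_bracketCl coef_bracketCr.
  rewrite derivM derivX mul1r; congr (_ + _); first by rewrite !(fP _).1.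
  congr (_ * _); rewrite derivB; congr (_ - _).
    by rewrite !derivM derivC mul0r add0r f2 !(fP _).1.
  by rewrite !derivM derivC mul0r add0r f2 !(fP _).1.
by rewrite dR; apply: exp_bracket_ode_ring.
Qed.

(** The map exp(c X delta_j) from A to A[X], built as a substitution so that it is multiplicative by
    construction. *)
Local Notation Eh := (mmap (polyC \o @mpolyC N k) f).

Lemma EhX i : Eh 'X_i = f i.
Proof. by rewrite mmapX mmap1U. Qed.

(** Both sides are derivations along [Eh] that kill the constants, so it suffices to compare them on
    the variables. *)
Lemma Eh_ode b : (Eh b)^`() = c%:MP%:P * pdelta (Eh b).
Proof.
have EhD x z : Eh (x + z) = Eh x + Eh z by exact: rmorphD.
have EhM x z : Eh (x * z) = Eh x * Eh z by exact: rmorphM.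
rewrite (derivation_chain (phi := Eh) (d := fun b => (Eh b)^`())); first last.
- by move=> a; rewrite mmapC derivC.
- by split=> x z; rewrite ?EhD ?EhM ?derivD ?derivM.
rewrite (derivation_chain (phi := Eh) (d := fun b => pdelta (Eh b))); first last.
- by move=> a; rewrite mmapC pdeltaC.
- by split=> x z; rewrite ?EhD ?EhM ?(pder_along _).1 ?(pder_along _).2.
rewrite mulr_sumr; apply: eq_bigr => i _.
by rewrite EhX (fP i).1 mulrCA.
Qed.

Lemma Eh_coef0 b : (Eh b)`_0 = b.
Proof.
elim/mpoly_alg_ind: b => [a|i|p0 q0 IHp IHq|p0 q0 IHp IHq].
- by rewrite mmapC /= coefC.
- by rewrite EhX (fP i).2.
- by rewrite mmapD coefD; apply: (congr2 +%R IHp IHq).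
- by rewrite [Eh _]rmorphM coef0M; apply: (congr2 *%R IHp IHq).
Qed.

Lemma exp_bracket_coef0 i i' : (exp_bracket i i')`_0 = B i i'.
Proof.
have c0 u a : (pd u (f a))`_0 = (u == a)%:R by rewrite coef_pd (fP a).2 mderivXU.
rewrite /exp_bracket coefD coefXM [X in _ + X]/= addr0.
transitivity (\sum_(u < N) \sum_(v < N) (u == i)%:R * (v == i')%:R * B u v).
  rewrite coef_sum; apply: eq_bigr => u _; rewrite coef_sum; apply: eq_bigr => v _.
  by rewrite [LHS]coef0M coefC [in LHS]coef0M; congr (_ * _ * _); apply: c0.
rewrite (bigD1 i) //= [X in _ + X]big1 => [|u /negPf ui]; last first.
  by rewrite big1 // => v _; rewrite ui !mul0r.
rewrite (bigD1 i') //= big1 => [|v /negPf vi]; first by rewrite !eqxx !mul1r !addr0.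
by rewrite vi mulr0 mul0r.
Qed.

Lemma Eh_bracket i i' : low i -> low i' -> Eh (B i i') = exp_bracket i i'.
Proof.
move=> li li'; apply/polyP=> m.
rewrite (exp_ode_coef k0 (Eh_ode _)) (exp_ode_coef k0 (exp_bracket_ode li li')).
by rewrite Eh_coef0 exp_bracket_coef0.
Qed.

Local Notation y' := (fun i => ev (f i)).

Lemma deleted_evalE b : mmap e y' b = ev (Eh b).
Proof.
elim/mpoly_alg_ind: b => [a|i|p0 q0 IHp IHq|p0 q0 IHp IHq].
- by rewrite !mmapC /= evC mmapC.
- by rewrite !mmapX !mmap1U.
- by rewrite !mmapD evD IHp IHq.
- by rewrite [LHS]rmorphM [Eh _]rmorphM evM; apply: (congr2 *%R IHp IHq).
Qed.

Lemma deleted_high i : ~~ low i -> ev (f i) = y i.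
Proof.
move=> hi; rewrite (_ : f i = ('X_i)%:P) ?evC ?phiX //.
apply/polyP=> [[|m]]; rewrite coefC /= ?(fP i).2 // coef_f iterSr.
rewrite (_ : ore_delta _ _ _ _ _ = 0); last by rewrite /ore_delta derX (negPf hi).
by rewrite (_ : iter m _ 0 = 0) ?mulr0 //; elim: m => //= m ->; apply: der0.
Qed.

(** The exponential is undone without constructing its inverse: [y j] is itself one of the new
    generators, and each old value is a new one minus terms with higher powers of delta_j, treated
    before it. *)
Lemma deleted_generates : generates e y'.
Proof.
have [_ _ gen] := stY => S Se SD SM SV Sy'; apply: (gen S) => //.
have Smmap b : S (mmap e y' b).
  elim/mpoly_alg_ind: b => [a|i|p0 q0 IHp IHq|p0 q0 IHp IHq].
  - by rewrite mmapC; apply: Se.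
  - by rewrite mmapX mmap1U; apply: Sy'.
  - by rewrite mmapD; apply: SD.
  - by rewrite rmorphM; apply: SM.
have Sj : S (y j) by rewrite -deleted_high ?ltnn //; apply: Sy'.
have Sev (g : {poly A}) : (forall m, S (phi g`_m)) -> S (ev g).
  elim/poly_ind: g => [|g a IH] Sg; first by rewrite ev0 -(rmorph0 e); apply: Se.
  rewrite evD evM evC evpX; apply: (SD).
    apply: (SM); last exact: SV.
    by apply: IH => m; have := Sg m.+1; rewrite coefD coefMX coefC /= addr0.
  by have := Sg 0%N; rewrite coefD coefMX coefC /= add0r.
(* Induction on the exponent killing b. Write [Eh b] as b + X h: the coefficients of h are multiples
   of positive powers of delta_j on b, to which the induction hypothesis applies. *)
have Sphi m b : iter m (ore_delta B r w j) b = 0 -> S (phi b).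
  elim: m b => [|m IH] b /= b0; first by rewrite b0 mmap0 -(rmorph0 e); apply: Se.
  have := Smmap b; rewrite deleted_evalE.
  have cE := exp_ode_coef k0 (Eh_ode b); rewrite Eh_coef0 in cE.
  have := Eh_coef0 b; move: cE; move: (Eh b) => h; elim/poly_ind: h => [|h a _].
    by move=> _; rewrite coef0 => <- _; rewrite mmap0 -(rmorph0 e); apply: Se.
  move=> cE; rewrite coefD coefMX coefC /= add0r => ab; rewrite evD evM evC evpX ab.
  move=> Sh; have -> : phi b = ev h * t + phi b + e (-1) * (ev h * t).
    by rewrite rmorphN rmorph1; ring.
  apply: (SD) => //; apply: (SM); [exact: Se | apply: (SM); last exact: SV].
  apply: Sev => i; have := cE i.+1; rewrite coefD coefMX coefC /= addr0 => ->.
  rewrite [mmap _ _ _]rmorphM /= mmapC; apply: (SM); [exact: Se | apply: IH].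
  rewrite -[X in iter m _ X]iterS -iterD addnS -addSn addnC iterD [iter m.+1 _ _]b0.
  by elim: i => //= i ->; apply: der0.
move=> i; case: (boolP (low i)) => li; last by rewrite -deleted_high //; apply: Sy'.
by have [m m0] := po_nil oreP li; rewrite -phiX; apply: (Sphi m).
Qed.

Lemma deletion_step_exp : deletion_stage (r j) y'.
Proof.
have [_ st _] := stY; split; last exact: deleted_generates.
- by move=> i i' li li'; rewrite br_f_f // deleted_evalE Eh_bracket.
move=> l i jl il.
have nl : ~~ low l by rewrite -leqNgt.
rewrite deleted_high //; case: (boolP (low i)) => li.
  move: jl; rewrite leq_eqVlt => /orP [/eqP /(po_inj oreP) <-|jl].
    exact: br_yj_f.
  exact: br_yl_f.
rewrite deleted_high // st //.
by move: li; rewrite -leqNgt => ji; apply: leq_ltn_trans il.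
Qed.

End Step.

Section Algorithm.
Variables (F : fieldType) (br : F -> F -> F) (e : {rmorphism k -> F}).
Hypothesis brP : poisson_bracket br.
Hypothesis bre : forall c x, br x (e c) = 0.

Lemma deletion_step t y : deletion_stage br e t.+1 y ->
  exists y', deletion_stage br e t y'.
Proof.
(* Ranks need not be consecutive, so there may be no variable of rank [t]. *)
move=> st; case: (pickP (fun j => r j == t)) => [j /eqP jt|nj]; last first.
  have rt i : (t <= r i)%N -> (t < r i)%N.
    by rewrite leq_eqVlt eq_sym nj.
  case: st => sa sb sc; exists y; split=> // [i i' li li'|j i /rt tj]; last exact: sb.
  by apply: sa; apply: ltnW.
subst t; case: (eqVneq (y j) 0) => [y0|y0].
  case: st => sa sb sc; exists y; split=> // [i i' li li'|l i].
    by apply: sa; apply: ltnW.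
  rewrite leq_eqVlt => /orP [/eqP /(po_inj oreP) <- _|]; last exact: sb.
  by rewrite y0 br0l // mulr0 mul0r.
(* If s_j = 0 the exponential is undefined, but then [po_shift] says that there is no delta_j to
   delete. *)
case: (eqVneq (w j j) 0) => [w0|w0].
  case: (po_shift oreP j) => [|lp0]; first by rewrite w0 eqxx.
  case: st => sa sb sc; exists y; split=> // [i i' li li'|l i].
    by apply: sa; apply: ltnW.
  rewrite leq_eqVlt => /orP [/eqP /(po_inj oreP) <- li|]; last exact: sb.
  rewrite sa // ?ltnS ?(ltnW li) //.
  have /eqP := lp0 _ li; rewrite subr_eq0 => /eqP ->.
  by rewrite !rmorphM /= mmapC !mmapX !mmap1U.
have [f fP] := exp_family j.
by eexists; apply: (deletion_step_exp brP bre st y0 w0 fP).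
Qed.

Theorem deletion_algorithm (y : 'I_N -> F) :
  (forall i j, br (y i) (y j) = mmap e y (B i j)) -> generates e y ->
  exists (z : 'I_N -> F) (mu : 'M[k]_N), [/\ mu^T = - mu,
    forall i j, br (z i) (z j) = e (mu i j) * z i * z j & generates e z].
Proof.
(* All ranks lie below [T], so the log-canonical clause is vacuous at stage [T]. *)
move=> yB yg; pose T := (\max_(i < N) r i).+1.
have {yB yg} : deletion_stage br e T y.
  by split=> // j i Tj; have := leq_trans Tj (leq_bigmax (F := r) j); rewrite ltnn.
elim: T y => [|T IH] y st; last by have [y' /IH] := deletion_step st.
case: st => _ sb sc; exists y.
exists (\matrix_(i, j) if (r j < r i)%N then w i j
                       else if (r i < r j)%N then - w j i else 0); split=> //.
  by apply/matrixP=> i j; rewrite !mxE; case: ltngtP; rewrite ?oppr0 ?opprK.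
move=> i j; rewrite mxE; case: ltngtP => [ji|ij|/(po_inj oreP) ->].
- exact: sb.
- by rewrite (brC brP) sb // rmorphN /=; ring.
have e2 : (2%:R : F) != 0 by rewrite -(rmorph_nat e) fmorph_eq0 natS_neq0.
have /eqP : br (y i) (y i) * 2%:R = 0.
  by rewrite mulr_natr mulr2n {1}(brC brP) addNr.
by rewrite mulf_eq0 (negPf e2) orbF => /eqP ->; rewrite rmorph0 !mul0r.
Qed.

End Algorithm.
End Deletion.

(** * Brackets on quotients and fractions *)

Section QuotientRule.
Variables (F : fieldType) (b d : F).
Hypotheses (b0 : b != 0) (d0 : d != 0).

Lemma quotient_ruleD (x y Ea Eb Ec Ed : F) :
  (Ea * d + x * b * Ed + (Ec * b + y * d * Eb) - (x + y) * (Eb * d + b * Ed)) / (b * d)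
  = (Ea - x * Eb) / b + (Ec - y * Ed) / d.
Proof. by field; rewrite b0 d0. Qed.

Lemma quotient_ruleM (x y Ea Eb Ec Ed : F) :
  (Ea * (y * d) + x * b * Ec - x * y * (Eb * d + b * Ed)) / (b * d)
  = (Ea - x * Eb) / b * y + x * ((Ec - y * Ed) / d).
Proof. by field; rewrite b0 d0. Qed.

Lemma quotient_rule2 (a c ac ad bc bd : F) :
  (ac * b * d - ad * b * c - bc * a * d + bd * a * c) / (b * b * d * d) =
  ((ac - c / d * ad) / d - a / b * ((bc - c / d * bd) / d)) / b.
Proof. by field; rewrite b0 d0. Qed.

End QuotientRule.

Section FractionDerivation.
Variable D : idomainType.
Local Notation F := {fraction D}.

Lemma frac_numden (x : F) : x * (\d_(repr x))%:F = (\n_(repr x))%:F.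
Proof.
rewrite -{1}[x]reprK; set u := repr x; unlock FracField.tofrac.
rewrite -[LHS]FracField.pi_mul; apply/eqmodP.
rewrite /= FracField.equivfE /FracField.mulf /= !numden_Ratio; first last.
all: rewrite ?mulr1 ?denom_ratioP ?oner_neq0 //.
by rewrite mulrC.
Qed.

Lemma frac_den_neq0 (x : F) : (\d_(repr x))%:F != 0 :> F.
Proof. by rewrite tofrac_eq0 denom_ratioP. Qed.

Lemma fracE (x : F) : x = (\n_(repr x))%:F / (\d_(repr x))%:F.
Proof. by rewrite -frac_numden mulfK // frac_den_neq0. Qed.

Definition frac_deriv (E : D -> F) (x : F) : F :=
  (E \n_(repr x) - x * E \d_(repr x)) / (\d_(repr x))%:F.

Section Ext.
Variable E : D -> F.
Hypothesis EP : derivation_along (@FracField.tofrac D) E.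

(** Independence of the representative: apply [E] to the cross relation n b = a d. *)
Lemma frac_derivE x a b : b != 0 -> x * b%:F = a%:F ->
  frac_deriv E x = (E a - x * E b) / b%:F.
Proof.
move=> b0 xb; rewrite /frac_deriv.
have := frac_numden x; have := frac_den_neq0 x.
move: (\n_(repr x)) (\d_(repr x)) => n d d0 xd.
have bF : b%:F != 0 :> F by rewrite tofrac_eq0.
have /(congr1 E) : n * b = a * d.
  by apply/eqP; rewrite -tofrac_eq !rmorphM /= -xd -xb mulrAC.
rewrite !EP.2 -xd -xb => H.
apply/eqP; rewrite eqr_div //; apply/eqP.
apply/eqP; rewrite -subr_eq0; apply/eqP.
have -> : (E n - x * E d) * b%:F - (E a - x * E b) * d%:F =
  (E n * b%:F + x * d%:F * E b) - (E a * d%:F + x * b%:F * E d) by ring.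
by rewrite H subrr.
Qed.

Lemma frac_deriv_along : derivation_along idfun (frac_deriv E).
Proof.
split=> x y /=;
  have [bx by_] := (frac_den_neq0 x, frac_den_neq0 y);
  have [dx dy] := (denom_ratioP (repr x), denom_ratioP (repr y));
  have [hx hy] := (frac_numden x, frac_numden y).
- rewrite (@frac_derivE (x + y) (\n_(repr x) * \d_(repr y) + \n_(repr y) * \d_(repr x))
     (\d_(repr x) * \d_(repr y))) ?mulf_neq0 //; last first.
    by rewrite rmorphD !rmorphM /= -hx -hy; ring.
  rewrite /frac_deriv EP.1 !EP.2 rmorphM /= -hx -hy.
  exact: quotient_ruleD.
rewrite (@frac_derivE (x * y) (\n_(repr x) * \n_(repr y))
     (\d_(repr x) * \d_(repr y))) ?mulf_neq0 //; last first.
  by rewrite !rmorphM /= -hx -hy; ring.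
rewrite /frac_deriv !EP.2 rmorphM /= -hx -hy.
exact: quotient_ruleM.
Qed.

Lemma frac_deriv_tofrac a : frac_deriv E a%:F = E a.
Proof.
rewrite (@frac_derivE a%:F a 1) ?oner_neq0 ?rmorph1 ?mulr1 //.
by rewrite (drv1 (phi := @FracField.tofrac D) EP) mulr0 subr0 divr1.
Qed.

End Ext.

Section Bracket.
Variable br : D -> D -> D.
Hypothesis brP : poisson_bracket br.

Lemma tofrac_br_along a : derivation_along (@FracField.tofrac D) (fun c => (br a c)%:F).
Proof.
by split=> x y; rewrite ?(brDr brP) ?(brMr brP) rmorphD ?rmorphM.
Qed.

(** The four-term formula is the quotient rule applied in one argument and then in the other; the
    biderivation property is inherited from [frac_deriv_along]. *)
Lemma fbrE x y :
  fbr br x y = frac_deriv (fun a => frac_deriv (fun c => (br a c)%:F) y) x.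
Proof.
rewrite /fbr /frac_deriv.
have [bx by_] := (frac_den_neq0 x, frac_den_neq0 y).
have [xE yE] := (fracE x, fracE y).
rewrite [in X in X = _]rmorphD !rmorphB /= !rmorphM /= quotient_rule2 //.
by rewrite -xE -yE.
Qed.

Lemma fbr_bracket : poisson_bracket (fbr br).
Proof.
have Ealong y : derivation_along (@FracField.tofrac D)
    (fun a => frac_deriv (fun c => (br a c)%:F) y).
  rewrite /frac_deriv; split=> a b.
    by rewrite !(brDl brP) !rmorphD /=; ring.
  by rewrite !(brMl brP) !rmorphD !rmorphM /=; ring.
split=> [x y z|x y z|x y].
- by rewrite !fbrE (frac_deriv_along (Ealong z)).1.
- by rewrite !fbrE (frac_deriv_along (Ealong z)).2.
rewrite /fbr; move: (\n_(repr x)) (\d_(repr x)) (\n_(repr y)) (\d_(repr y)).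
move=> a b c d; rewrite [X in X%:F / _ = _](_ : _ =
    - (br c a * d * b - br c b * d * a - br d a * c * b + br d b * c * a)).
  by rewrite tofracN mulNr; congr (- (_ / _%:F)); ring.
by rewrite (brC brP a c) (brC brP a d) (brC brP b c) (brC brP b d); ring.
Qed.

Lemma fbr_tofrac a b : fbr br a%:F b%:F = (br a b)%:F.
Proof.
have Ealong y : derivation_along (@FracField.tofrac D)
    (fun a => frac_deriv (fun c => (br a c)%:F) y).
  rewrite /frac_deriv; split=> c d.
    by rewrite !(brDl brP) !rmorphD /=; ring.
  by rewrite !(brMl brP) !rmorphD !rmorphM /=; ring.
rewrite fbrE frac_deriv_tofrac // frac_deriv_tofrac //.
exact: tofrac_br_along.
Qed.

End Bracket.
End FractionDerivation.

Section QuotientBracket.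
Local Open Scope quotient_scope.
Variables (R : comNzRingType) (P : prime_idealr R) (br : R -> R -> R).
Hypotheses (brP : poisson_bracket br) (PP : poisson_ideal br P).

Local Notation pr := (\pi_({ideal_quot P})).

Lemma qbr_pi a b : @qbr _ P br (pr a) (pr b) = pr (br a b).
Proof.
have rP c : repr (pr c) - c \in P by rewrite Quotient.idealrBE reprK.
apply/eqP; rewrite /qbr -Quotient.idealrBE.
move: (repr (pr a)) (rP a) (repr (pr b)) (rP b) => a' aP b' bP.
have -> : br a' b' - br a b = br a' (b' - b) - br b (a' - a).
  rewrite !(drvB (br_along_r brP _)) (brC brP b a') (brC brP b a).
  by ring.
by rewrite rpredB //; apply: PP.
Qed.

Lemma qbr_bracket : poisson_bracket (@qbr _ P br).
Proof.
split=> x y; rewrite -[x]reprK -[y]reprK.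
- move=> z; rewrite -[z]reprK -[pr _ + pr _]rmorphD !qbr_pi -[RHS]rmorphD.
  by congr (pr _); apply: brDl.
- move=> z; rewrite -[z]reprK -[pr _ * pr _]rmorphM !qbr_pi -2![pr _ * pr _]rmorphM.
  by rewrite -[RHS]rmorphD; congr (pr _); apply: brMl.
by rewrite !qbr_pi -[RHS]rmorphN; congr (pr _); apply: brC.
Qed.

End QuotientBracket.

Section FractionIso.
Variables (R : idomainType) (F : fieldType) (Phi : {rmorphism R -> F}).
Hypothesis PhiI : forall a, Phi a = 0 -> a = 0.

Lemma Phi_neq0 a : a != 0 -> Phi a != 0.
Proof. by apply: contraNneq => /PhiI ->. Qed.

Definition frac_lift (x : {fraction R}) : F := Phi \n_(repr x) / Phi \d_(repr x).

Lemma frac_liftE x a b : b != 0 -> x * b%:F = a%:F -> frac_lift x = Phi a / Phi b.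
Proof.
move=> b0 xb; have := frac_numden x; have := denom_ratioP (repr x); rewrite /frac_lift.
move: (\n_(repr x)) (\d_(repr x)) => n d d0 xd.
apply/eqP; rewrite eqr_div ?Phi_neq0 // -!rmorphM /=; apply/eqP; congr (Phi _).
by apply/eqP; rewrite -tofrac_eq !rmorphM /= -xd -xb mulrAC.
Qed.

Lemma frac_liftD x y : frac_lift (x + y) = frac_lift x + frac_lift y.
Proof.
have [dx dy] := (denom_ratioP (repr x), denom_ratioP (repr y)).
have [hx hy] := (frac_numden x, frac_numden y).
rewrite (@frac_liftE _ (\n_(repr x) * \d_(repr y) + \n_(repr y) * \d_(repr x))
     (\d_(repr x) * \d_(repr y))) ?mulf_neq0 //; last first.
  by rewrite rmorphD !rmorphM /= -hx -hy; ring.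
rewrite /frac_lift rmorphD !rmorphM /=.
by field; rewrite !Phi_neq0.
Qed.

Lemma frac_liftM x y : frac_lift (x * y) = frac_lift x * frac_lift y.
Proof.
have [dx dy] := (denom_ratioP (repr x), denom_ratioP (repr y)).
have [hx hy] := (frac_numden x, frac_numden y).
rewrite (@frac_liftE _ (\n_(repr x) * \n_(repr y))
     (\d_(repr x) * \d_(repr y))) ?mulf_neq0 //; last first.
  by rewrite !rmorphM /= -hx -hy; ring.
by rewrite /frac_lift !rmorphM /=; field; rewrite !Phi_neq0.
Qed.

Lemma frac_lift_tofrac a : frac_lift a%:F = Phi a.
Proof.
by rewrite (@frac_liftE _ a 1) ?oner_neq0 ?rmorph1 ?mulr1 ?divr1.
Qed.

Lemma frac_lift_inj : injective frac_lift.
Proof.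
move=> x y /eqP; rewrite eqr_div ?Phi_neq0 ?denom_ratioP // -!rmorphM /= -subr_eq0.
rewrite -rmorphB => /eqP /PhiI /eqP; rewrite subr_eq0 => /eqP H.
rewrite (fracE x) (fracE y); apply/eqP; rewrite eqr_div ?frac_den_neq0 //.
by rewrite -!rmorphM /= H.
Qed.

Lemma frac_lift_br (br : F -> F -> F) (brR : R -> R -> R) : poisson_bracket br ->
  (forall a b, br (Phi a) (Phi b) = Phi (brR a b)) ->
  forall x y, frac_lift (fbr brR x y) = br (frac_lift x) (frac_lift y).
Proof.
move=> brP PhiB x y.
have [dx dy] := (denom_ratioP (repr x), denom_ratioP (repr y)).
rewrite (@frac_liftE _ _ _ _ (divfK _ _)); last 2 first.
- by rewrite !mulf_neq0.
- by rewrite tofrac_eq0 !mulf_neq0.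
rewrite /frac_lift !(brMl brP, brMr brP).
have inv_r z u : br z u^-1 = - (br z u * u^-2).
  exact: (derivation_inv _ (br_along_r brP z)).
have inv_l z u : br u^-1 z = - (br u z * u^-2).
  exact: (derivation_inv _ (br_along_l brP z)).
rewrite !inv_r !inv_l ?inv_r !PhiB rmorphD !rmorphB /= !rmorphM /=.
by field; rewrite !Phi_neq0.
Qed.

Lemma frac_iso (br : F -> F -> F) (brR : R -> R -> R) : poisson_bracket br ->
  (forall a b, br (Phi a) (Phi b) = Phi (brR a b)) ->
  (forall x, exists z, frac_lift z = x) ->
  exists f : F -> {fraction R}, [/\ bijective f,
    (forall x y, f (x + y) = f x + f y),
    (forall x y, f (x * y) = f x * f y) /\ f 1 = 1,
    (forall a, f (Phi a) = a%:F) &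
    (forall x y, f (br x y) = fbr brR (f x) (f y))].
Proof.
move=> brP PhiB surj.
pose f x := proj1_sig (constructive_indefinite_description _ (surj x)).
have fK : cancel f frac_lift.
  by move=> x; rewrite /f; case: constructive_indefinite_description.
have gK : cancel frac_lift f by move=> z; apply: frac_lift_inj; rewrite fK.
exists f; split.
- by exists frac_lift.
- by move=> x y; apply: frac_lift_inj; rewrite frac_liftD !fK.
- split=> [x y|]; apply: frac_lift_inj; first by rewrite frac_liftM !fK.
  by rewrite fK -[in RHS](tofrac1 R) frac_lift_tofrac rmorph1.
- by move=> a; rewrite -frac_lift_tofrac gK.
- by move=> x y; apply: frac_lift_inj; rewrite (frac_lift_br brP PhiB) !fK.
Qed.

End FractionIso.

Lemma br_mmap (K F : fieldType) (n : nat) (eK : {rmorphism K -> F}) (z : 'I_n -> F)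
    (br : F -> F -> F) (B : 'I_n -> 'I_n -> {mpoly K[n]}) :
  poisson_bracket br -> (forall c x, br x (eK c) = 0) ->
  (forall i j, br (z i) (z j) = mmap eK z (B i j)) ->
  forall a b, br (mmap eK z a) (mmap eK z b) = mmap eK z (pbr B a b).
Proof.
move=> brP bre zB a b.
have mD x y : mmap eK z (x + y) = mmap eK z x + mmap eK z y by exact: rmorphD.
have mM x y : mmap eK z (x * y) = mmap eK z x * mmap eK z y by exact: rmorphM.
rewrite (derivation_chain (phi := mmap eK z) (d := fun a => br (mmap eK z a) (mmap eK z b))).
- rewrite /pbr [RHS]rmorph_sum; apply: eq_bigr => i _ /=; rewrite mmapX mmap1U.
  rewrite (derivation_chain (phi := mmap eK z) (d := fun b => br (z i) (mmap eK z b))).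
  + rewrite [RHS]rmorph_sum mulr_sumr; apply: eq_bigr => j _ /=.
    by rewrite mmapX mmap1U zB !mM mulrA.
  + by split=> x y; rewrite ?mD ?mM ?(brDr brP) ?(brMr brP).
  by move=> c; rewrite mmapC bre.
- by split=> x y; rewrite ?mD ?mM ?(brDl brP) ?(brMl brP).
by move=> c; rewrite mmapC (brC brP) bre oppr0.
Qed.

(** Generation makes the map from the rational function field to F surjective; algebraic
    independence of the [z] over K lets it be defined on fractions and makes it injective. *)
Lemma rational_iso (K F : fieldType) (n : nat) (eK : {rmorphism K -> F}) (z : 'I_n -> F)
    (br : F -> F -> F) (B : 'I_n -> 'I_n -> {mpoly K[n]}) :
  poisson_bracket br -> (forall c x, br x (eK c) = 0) ->
  (forall i j, br (z i) (z j) = mmap eK z (B i j)) ->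
  generates eK z -> (forall a, mmap eK z a = 0 -> a = 0) ->
  exists f : F -> {fraction {mpoly K[n]}}, [/\ bijective f,
    (forall x y, f (x + y) = f x + f y),
    (forall x y, f (x * y) = f x * f y) /\ f 1 = 1,
    (forall c, f (eK c) = (c%:MP)%:F) &
    (forall x y, f (br x y) = fbr (pbr B) (f x) (f y))].
Proof.
move=> brP bre zB gen inj.
have surj x : exists a, frac_lift (mmap eK z) a = x.
  apply: (gen (fun x => exists a, frac_lift (mmap eK z) a = x)) => {x}.
  - by move=> c; exists (c%:MP)%:F; rewrite frac_lift_tofrac //= mmapC.
  - by move=> _ _ [a <-] [b <-]; exists (a + b); rewrite frac_liftD.
  - by move=> _ _ [a <-] [b <-]; exists (a * b); rewrite frac_liftM.
  - move=> _ [a <-]; exists a^-1.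
    case: (eqVneq a 0) => [->|a0].
      have l0 : frac_lift (mmap eK z) 0 = 0.
        by rewrite -tofrac0 frac_lift_tofrac // rmorph0.
      by rewrite invr0 l0 invr0.
    have H : frac_lift (mmap eK z) a * frac_lift (mmap eK z) a^-1 = 1.
      by rewrite -frac_liftM // mulfV // -tofrac1 frac_lift_tofrac // rmorph1.
    apply: (mulfI (x := frac_lift (mmap eK z) a)); last first.
      rewrite H mulfV //; apply: contra_eq_neq H => ->.
      by rewrite mul0r eq_sym oner_neq0.
    by apply: contra_eq_neq H => ->; rewrite mul0r eq_sym oner_neq0.
  by move=> i; exists ('X_i)%:F; rewrite frac_lift_tofrac //= mmapX mmap1U.
have [f [fb fD fM fE fB]] := frac_iso inj brP (br_mmap brP bre zB) surj.
by exists f; split=> // c; rewrite -fE /= mmapC.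
Qed.

(** * Algebraic independence through the Jacobian matrix *)

Section Jacobian.
Variables (k F : fieldType) (e : {rmorphism k -> F}) (n : nat).
Variables (d : 'I_n -> F -> F) (x y : 'I_n -> F).
Hypothesis k0 : [pchar k] =i pred0.
Hypothesis dP : forall i, derivation_along idfun (d i).
Hypothesis de : forall i c, d i (e c) = 0.
Hypothesis dx : forall i l, d i (x l) = (i == l)%:R.
Hypothesis gen : generates e y.

(** A row vector v in the kernel gives a derivation, the sum of the v_i d_i, that kills the
    generators [y] and hence F; its values on the [x l] are the entries of v. *)
Lemma jacobian_unit : \matrix_(i < n, j < n) d i (y j) \in unitmx.
Proof.
rewrite -row_free_unit -kermx_eq0; apply/rowV0P => v /sub_kermxP vJ.
pose D z := \sum_i v 0 i * d i z.
have DP : derivation_along idfun D.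
  split=> a b; rewrite /D ?mulr_suml ?mulr_sumr -big_split; apply: eq_bigr => i _ /=.
    by rewrite (dP i).1 mulrDr.
  by rewrite (dP i).2 /=; ring.
have D0 z : D z = 0.
  refine (@gen (fun z => D z = 0) _ _ _ _ _ z) => {z}.
  - by move=> c; rewrite /D big1 // => i _; rewrite de mulr0.
  - by move=> a b Da Db; rewrite DP.1 Da Db addr0.
  - by move=> a b Da Db; rewrite DP.2 Da Db mul0r mulr0 addr0.
  - by move=> a Da; rewrite (derivation_inv _ DP) Da mul0r oppr0.
  move=> j; move/rowP: vJ => /(_ j); rewrite !mxE => H.
  by rewrite -[RHS]H; apply: eq_bigr => i _; rewrite mxE.
apply/rowP=> l; rewrite mxE -[RHS](D0 (x l)) /D (bigD1 l) //= dx eqxx mulr1.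
by rewrite big1 ?addr0 // => i /negPf il; rewrite dx il mulr0.
Qed.

(** Induction on the degree. Applying the d_i to a(y) = 0 and inverting the Jacobian matrix shows
    that all partial derivatives of a vanish at y, hence are zero. In characteristic zero a is then
    constant. *)
Lemma generators_alg_independent a : mmap e y a = 0 -> a = 0.
Proof.
have [D0] : exists D, forall m, (D <= mdeg m)%N -> a@_m = 0.
  by exists (msize a) => m /msize_mdeg_ge /memN_msupp_eq0.
elim: D0 a => [|D IH] a aD ya; first by apply/mpolyP => m; rewrite mcoeff0 aD.
have da j : mderiv j a = 0.
  apply: IH => [m Dm|].
    by rewrite mcoeff_mderiv aD ?mul0rn // mdegD mdeg1 addn1 ltnS.
  pose J := \matrix_(i < n, j < n) d i (y j).
  pose cm := \col_j mmap e y (mderiv j a).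
  have Jc : J *m cm = 0.
    apply/colP=> i; rewrite !mxE.
    apply: etrans (_ : _ = d i (mmap e y a)) _; last by rewrite ya (drv0 (dP i)).
    rewrite (derivation_chain (phi := mmap e y) (d := fun b => d i (mmap e y b))); first last.
    - by move=> c; rewrite /= mmapC de.
    - by split=> b c /=; rewrite ?rmorphD ?rmorphM /= ?(dP i).1 ?(dP i).2.
    by apply: eq_bigr => l _; rewrite !mxE /= mmapX mmap1U mulrC.
  have : cm = 0 by rewrite -[cm](mulKmx jacobian_unit) Jc mulmx0.
  by move/colP/(_ j); rewrite !mxE.
have am m : m != 0%MM -> a@_m = 0.
  rewrite -mdeg_eq0 mdegE sum_nat_eq0 negb_forall => /existsP [j /= mj].
  have := congr1 (mcoeff (m - U_(j))) (da j).
  rewrite mcoeff_mderiv mcoeff0 submK; last first.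
    by apply/mnm_lepP=> i; rewrite mnm1E; case: eqP => // <-; rewrite lt0n.
  by move/eqP; rewrite -mulr_natr mulf_eq0 (negPf (natS_neq0 k0 _)) orbF => /eqP.
have aE : a = (a@_0%MM)%:MP.
  apply/mpolyP=> m; rewrite mcoeffC; case: (eqVneq m 0%MM) => [->|m0].
    by rewrite mulr1.
  by rewrite mulr0 am.
move: ya; rewrite aE mmapC => /eqP; rewrite fmorph_eq0 => /eqP ->.
exact: mpolyC0.
Qed.

End Jacobian.

(** * The Poisson centre as a field *)

Section Centre.
Variables (F : fieldType) (br : F -> F -> F).
Hypothesis brP : poisson_bracket br.

(** The proof that [br] is a Poisson bracket is an argument so that closure under division, which
    depends on it, can be attached to the predicate as an instance. *)
Definition centre_pred of poisson_bracket br : {pred F} := fun x =>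
  if excluded_middle_informative (forall y, br y x = 0) then true else false.

Lemma centreP x : reflect (forall y, br y x = 0) (x \in centre_pred brP).
Proof.
by rewrite /centre_pred unfold_in; case: excluded_middle_informative => H; constructor.
Qed.

Lemma centre_divring : divring_closed (centre_pred brP).
Proof.
split=> [|x z /centreP Hx /centreP Hz|x z /centreP Hx /centreP Hz]; apply/centreP=> y.
- exact: br1r.
- by rewrite (drvB (br_along_r brP y)) Hx Hz subr0.
by rewrite (brMr brP) (derivation_inv _ (br_along_r brP y)) Hx Hz !mul0r oppr0 mulr0 addr0.
Qed.

HB.instance Definition _ := GRing.isDivringClosed.Build F (centre_pred brP) centre_divring.

Record centre := Centre { centre_val :> F; _ : centre_val \in centre_pred brP }.
HB.instance Definition _ := [isSub for centre_val].
HB.instance Definition _ := [Choice of centre by <:].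
HB.instance Definition _ := [SubChoice_isSubIntegralDomain of centre by <:].
HB.instance Definition _ := [SubIntegralDomain_isSubField of centre by <:].

Lemma br_centre (c : centre) x : br x (val c) = 0.
Proof. by case: c => c cP; apply: (centreP _ cP). Qed.

Section Scalars.
Variables (k : fieldType) (e : {rmorphism k -> F}).
Hypothesis bre : forall c x, br x (e c) = 0.

Lemma scalar_central c : e c \in centre_pred brP.
Proof. by apply/centreP => y; apply: bre. Qed.

Definition to_centre (c : k) : centre := Centre (scalar_central c).

Lemma to_centre_zmod : zmod_morphism to_centre.
Proof. by move=> a b; apply: val_inj; rewrite /= !rmorphB. Qed.

Lemma to_centre_monoid : monoid_morphism to_centre.
Proof. by split=> [|a b]; apply: val_inj; rewrite /= ?rmorph1 ?rmorphM. Qed.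

HB.instance Definition _ := GRing.isZmodMorphism.Build k centre to_centre to_centre_zmod.
HB.instance Definition _ := GRing.isMonoidMorphism.Build k centre to_centre to_centre_monoid.

End Scalars.
End Centre.

(** * Log-canonical generators *)

Lemma mmap_qtorus_gen (k K F : fieldType) (iota : k -> K) (eK : {rmorphism K -> F})
    m (z : 'I_m -> F) (mu : 'M[k]_m) i j :
  mmap eK z (qtorus_gen iota mu i j) = eK (iota (mu i j)) * z i * z j.
Proof. by rewrite /qtorus_gen !rmorphM /= mmapC !mmapX !mmap1U. Qed.

Section LogCanonical.
Variables (k F : fieldType) (e : {rmorphism k -> F}) (br : F -> F -> F).
Hypothesis k0 : [pchar k] =i pred0.
Hypothesis brP : poisson_bracket br.
Hypothesis bre : forall c x, br x (e c) = 0.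

Local Notation Z := (centre brP).
Local Notation central x := (forall y, br y x = 0).

(** Generation is over the Poisson centre rather than over k, so that a central generator may be
    discarded. *)
Definition log_canonical m (z : 'I_m -> F) (mu : 'M[k]_m) : Prop :=
  [/\ mu^T = - mu, forall i j, br (z i) (z j) = e (mu i j) * z i * z j
    & generates (val : Z -> F) z].

(** Since {z^u, z_j} is the sum of the u_i mu_ij times z^u z_j, this says that no nontrivial Laurent
    monomial is central, provided that the z_i are nonzero. *)
Definition nondegenerate m (mu : 'M[k]_m) : Prop :=
  forall u : 'I_m -> int, (forall j, \sum_i (u i)%:~R * mu i j = 0) -> u =1 fun=> 0.

Lemma central_generators m (z : 'I_m -> F) x : generates (val : Z -> F) z ->
  (forall i, br x (z i) = 0) -> central x.
Proof.
move=> gen xz y; rewrite (brC brP); apply/eqP; rewrite oppr_eq0; apply/eqP.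
have xP := br_along_r brP x.
apply: (gen (fun y => br x y = 0)) => // {y}.
- by move=> c; apply: br_centre.
- by move=> a b xa xb; rewrite xP.1 xa xb addr0.
- by move=> a b xa xb; rewrite xP.2 xa xb mul0r mulr0 addr0.
- by move=> a xa; rewrite (derivation_inv _ xP) xa mul0r oppr0.
Qed.

Lemma log_canonical_drop m (z : 'I_m.+1 -> F) mu i : log_canonical z mu ->
  central (z i) -> log_canonical (z \o lift i) (mxsub (lift i) (lift i) mu).
Proof.
move=> [muT zz gen] zi; split.
- apply/matrixP=> a b; rewrite !mxE.
  by have /matrixP/(_ (lift i a) (lift i b)) := muT; rewrite !mxE.
- by move=> a b; rewrite mxE; apply: zz.
move=> S Sc SD SM SV Sz; apply: (gen S) => // j.
case: (unliftP i j) => [j'|] ->; first exact: Sz.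
by apply: (Sc (Centre (introT (centreP brP _) zi))).
Qed.

Lemma anti_entry m (mu : 'M[k]_m) i j : mu^T = - mu -> mu j i = - mu i j.
Proof. by move/matrixP/(_ i j); rewrite !mxE. Qed.

(** An elementary change of basis of the lattice of exponents; the matrix becomes E mu E^T with E
    adding row i to row j. *)
Lemma log_canonical_shear m (z : 'I_m -> F) (mu : 'M[k]_m) i j :
  log_canonical z mu -> (forall a, z a != 0) -> i != j ->
  log_canonical (fun a => if a == j then z j * z i else z a)
    (\matrix_(a, b) (mu a b + (a == j)%:R * mu i b + (b == j)%:R * mu a i
                     + (a == j)%:R * (b == j)%:R * mu i i)).
Proof.
move=> [muT zz gen] z0 ij; split.
- apply/matrixP=> a b; rewrite !mxE (anti_entry a b muT) (anti_entry a i muT).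
  rewrite (anti_entry i b muT).
  have mii : mu i i = - mu i i by exact: anti_entry.
  by rewrite {1}mii; ring.
- move=> a b; rewrite mxE !rmorphD !rmorphM /= !rmorph_nat.
  case: (eqVneq a j) => [->|_]; case: (eqVneq b j) => [->|_];
    rewrite ?(brMl brP) ?(brMr brP) ?(brMl brP) !zz; rewrite ?mulr1n ?mulr0n; ring.
move=> S Sc SD SM SV Sz; apply: (gen S) => // a.
have Si : S (z i) by have := Sz i; rewrite (negPf ij).
case: (eqVneq a j) => [->|aj]; last by have := Sz a; rewrite (negPf aj).
have := Sz j; rewrite eqxx => Sji.
by rewrite -(mulfK (z0 i) (z j)); apply: SM => //; apply: SV.
Qed.

Lemma log_canonical_flip m (z : 'I_m -> F) (mu : 'M[k]_m) (s : 'I_m -> bool) :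
  log_canonical z mu -> (forall a, z a != 0) ->
  log_canonical (fun a => if s a then (z a)^-1 else z a)
    (\matrix_(a, b) ((-1) ^+ s a * (-1) ^+ s b * mu a b)).
Proof.
move=> [muT zz gen] z0; split.
- by apply/matrixP=> a b; rewrite !mxE (anti_entry a b muT); ring.
- have invr x y : br x y^-1 = - (br x y * y^-2).
    exact: (derivation_inv _ (br_along_r brP x)).
  have invl x y : br x^-1 y = - (br x y * x^-2).
    exact: (derivation_inv _ (br_along_l brP y)).
  move=> a b; rewrite mxE !rmorphM /= !rmorph_sign.
  case: (s a); case: (s b); rewrite ?invr ?invl ?invr ?zz ?expr1 ?expr0;
    field; rewrite ?z0 //.
move=> S Sc SD SM SV Sz; apply: (gen S) => // a.
by have := Sz a; case: (s a) => // /SV; rewrite invrK.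
Qed.

Lemma single_relation m (z : 'I_m -> F) (mu : 'M[k]_m) i : log_canonical z mu ->
  (forall j, mu i j = 0) -> central (z i).
Proof.
move=> [muT zz gen] mui; apply: (central_generators gen) => j.
by rewrite zz mui rmorph0 !mul0r.
Qed.

(* Euclid's algorithm on the exponent vector of a central monomial. *)
Lemma central_monomial_reduce_nat m (z : 'I_m -> F) (mu : 'M[k]_m) (u : 'I_m -> nat) :
  log_canonical z mu -> (forall a, z a != 0) -> (exists i, u i != 0%N) ->
  (forall j, \sum_i (u i)%:R * mu i j = 0) ->
  exists (z' : 'I_m -> F) (mu' : 'M[k]_m),
    log_canonical z' mu' /\ exists i, central (z' i).
Proof.
have [n] := ubnP (\sum_i u i)%N.
elim: n z mu u => // n IH z mu u un zP z0 [i0 ui0] ru.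
case: (pickP (fun p : 'I_m * 'I_m => [&& p.1 != p.2, u p.2 != 0%N & (u p.2 <= u p.1)%N]))
  => [[i j] /= /and3P [ij uj uji]|none].
  (* From z_i^(u_i) z_j^(u_j) = z_i^(u_i - u_j) (z_j z_i)^(u_j): the same monomial in the sheared
     generators has a smaller exponent sum. *)
  pose u' a := if a == i then (u i - u j)%N else u a.
  have u'i : u' i = (u i - u j)%N by rewrite /u' eqxx.
  have u'n a : a != i -> u' a = u a by rewrite /u' => /negPf ->.
  have u'j : u' j = u j by rewrite u'n // eq_sym.
  have su' : (\sum_a u a = u j + \sum_a u' a)%N.
    rewrite (bigD1 i) //= [in RHS](bigD1 i) //= u'i addnA subnKC //.
    by congr (_ + _)%N; apply: eq_bigr => a ai; rewrite u'n.
  apply: (IH _ _ u' _ (log_canonical_shear zP z0 ij)).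
  - by rewrite -ltnS (leq_trans _ un) // su' ltnS -[X in (X <= _)%N]add1n leq_add2r lt0n.
  - by move=> a; case: ifP => _ //; rewrite mulf_neq0.
  - by exists j; rewrite u'j.
  have S1 b : \sum_a (u' a)%:R * mu a b = - ((u j)%:R * mu i b).
    apply/eqP; rewrite -addr_eq0 -[X in _ == X](ru b); apply/eqP.
    rewrite (bigD1 i) //= [in RHS](bigD1 i) //= u'i natrB //.
    rewrite addrAC -mulrDl subrK; congr (_ + _).
    by apply: eq_bigr => a ai; rewrite u'n.
  have S2 (h : 'I_m -> k) : \sum_a (u' a)%:R * ((a == j)%:R * h a) = (u j)%:R * h j.
    rewrite (bigD1 j) //= eqxx mul1r u'j big1 ?addr0 //.
    by move=> a /negPf ->; rewrite mul0r mulr0.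
  move=> b.
  transitivity (\sum_a (u' a)%:R * mu a b + \sum_a (u' a)%:R * ((a == j)%:R * mu i b)
     + (b == j)%:R * (\sum_a (u' a)%:R * mu a i
     + \sum_a (u' a)%:R * ((a == j)%:R * mu i i))).
    rewrite -!big_split mulr_sumr -big_split; apply: eq_bigr => a _.
    by rewrite mxE /=; ring.
  by rewrite !S1 (S2 (fun=> mu i b)) (S2 (fun=> mu i i)) !addNr mulr0 addr0.
(* Of any two nonzero exponents the smaller could still be subtracted, so only [u i0] is nonzero,
   and characteristic zero lets it be cancelled from the relation. *)
exists z, mu; split=> //; exists i0; apply: (single_relation zP) => j.
have uz i : i != i0 -> u i = 0%N.
  move=> ii0; apply/eqP; apply: contraT => ui.
  by case/orP: (leq_total (u i) (u i0)) => le;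
    [have := none (i0, i) | have := none (i, i0)]; rewrite /= ?ui ?ui0 le ?ii0 // eq_sym ii0.
have := ru j; rewrite (bigD1 i0) //= big1 ?addr0 => [|i ii0]; last first.
  by rewrite uz // mul0r.
by move/eqP; rewrite mulf_eq0 ((pcharf0P k).1 k0 (u i0)) (negPf ui0) => /eqP.
Qed.

Lemma central_monomial_reduce m (z : 'I_m -> F) (mu : 'M[k]_m) :
  log_canonical z mu -> (forall a, z a != 0) -> ~ nondegenerate mu ->
  exists (z' : 'I_m -> F) (mu' : 'M[k]_m),
    log_canonical z' mu' /\ exists i, central (z' i).
Proof.
move=> zP z0 nd.
have [u [ru [i ui]]] : exists u : 'I_m -> int,
    (forall j, \sum_i (u i)%:~R * mu i j = 0) /\ exists i, u i != 0.
  apply: NNPP => H; apply: nd => u ru i; apply/eqP; apply: contraT => ui.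
  by case: H; exists u; split=> //; exists i.
(* Inverting the generators with negative exponent makes the exponent vector nonnegative. *)
pose s a := u a < 0.
apply: (central_monomial_reduce_nat (u := fun a => absz (u a))
  (log_canonical_flip s zP z0)).
- by move=> a; case: ifP => _; rewrite ?invr_eq0.
- by exists i; rewrite absz_eq0.
move=> j; apply: etrans (_ : (-1) ^+ s j * (\sum_i (u i)%:~R * mu i j) = 0); last first.
  by rewrite ru mulr0.
rewrite mulr_sumr; apply: eq_bigr => a _; rewrite mxE.
have -> : (u a)%:~R = (absz (u a))%:R * (-1) ^+ s a :> k.
  rewrite /s; case: (u a) => l /=; rewrite ?mulr1 //.
  by rewrite NegzE mulrNz expr1 mulrN1.
by ring.
Qed.

(** By induction on the number of generators: a zero generator is central, and a degenerate matrix
    yields a central generator after a change of basis; either way one generator is dropped. *)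
Lemma log_canonical_normalize m (z : 'I_m -> F) (mu : 'M[k]_m) :
  log_canonical z mu -> exists n (z' : 'I_n -> F) (mu' : 'M[k]_n),
    [/\ log_canonical z' mu', forall i, z' i != 0 & nondegenerate mu'].
Proof.
elim: m z mu => [|m IH] z mu zP.
  by exists 0%N, z, mu; split=> // [|u _] [].
have drop (z1 : 'I_m.+1 -> F) mu1 i : log_canonical z1 mu1 -> central (z1 i) -> _ :=
  fun zP1 zi => IH _ _ (log_canonical_drop zP1 zi).
case: (pickP (fun i => z i == 0)) => [i /eqP zi|z0].
  by apply: (drop z mu i zP) => y; rewrite zi br0r.
have {}z0 i : z i != 0 by rewrite z0.
case: (classic (nondegenerate mu)) => [nd|]; first by exists m.+1, z, mu.
by move/(central_monomial_reduce zP z0) => [z' [mu' [zP' [i zi]]]]; apply: (drop _ _ _ zP' zi).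
Qed.

Section Independence.
Variables (m : nat) (z : 'I_m -> F) (mu : 'M[k]_m).
Hypotheses (zP : log_canonical z mu) (z0 : forall i, z i != 0).
Hypothesis nd : nondegenerate mu.

Local Notation wt b n := (\sum_i mu b i * (n i)%:R).

Lemma br_monomial b (n : 'X_{1..m}) :
  br (z b) (mmap1 z n) = e (wt b n) * z b * mmap1 z n.
Proof.
have [_ zz _] := zP.
rewrite /mmap1; elim/big_rec2: _ => [|i x y _ IH].
  by rewrite (br1r brP) rmorph0 !mul0r.
have brX a : br (z b) (z i ^+ a) = e (mu b i * a%:R) * z b * z i ^+ a.
  elim: a => [|a IHa]; first by rewrite expr0 (br1r brP) mulr0 rmorph0 !mul0r.
  by rewrite exprS (brMr brP) IHa zz !rmorphM /= !rmorph_nat -natr1; ring.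
by rewrite (brMr brP) brX IH rmorphD /=; ring.
Qed.

(* Distinct monomials are eigenvectors for distinct characters of the *)
(* commuting derivations [z_b^-1 {z_b, -}], all trivial on the centre. *)
Lemma monomials_independent (s : seq 'X_{1..m}) (c : 'X_{1..m} -> F) :
  uniq s -> (forall n, central (c n)) -> \sum_(n <- s) c n * mmap1 z n = 0 ->
  forall n, n \in s -> c n = 0.
Proof.
elim: s c => // n0 s IH c /= /andP [n0s us] cz.
rewrite big_cons => S0.
have cs n : n \in s -> c n = 0.
  move=> ns; case: (pickP (fun b => wt b n != wt b n0)) => [b wb|eqw]; last first.
    have [muT _ _] := zP.
    suff nn0 : n = n0 by move: n0s; rewrite -nn0 ns.
    (* If all weights agree, the difference of the exponent vectors is an integral relation on [mu],
       hence zero. *)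
    have H : (fun i => (n i)%:Z - (n0 i)%:Z) =1 fun=> 0.
      apply: nd => j; have /negbFE/eqP wj := eqw j.
      transitivity (- (wt j n - wt j n0)); last by rewrite wj subrr oppr0.
      rewrite -sumrB -sumrN; apply: eq_bigr => i _.
      by rewrite rmorphB /= (anti_entry j i muT); ring.
    by apply/mnmP=> i; have /eqP := H i; rewrite subr_eq0 => /eqP [].
  (* Apply {z_b, -} to the relation, divide by z_b and subtract [wt b n0] times the relation: the
     term of [n0] disappears, and the other coefficients are multiplied by differences of
     weights. *)
  pose c' n := c n * e (wt b n - wt b n0).
  have c'z n1 : central (c' n1).
    by move=> y; rewrite (brMr brP) cz bre mul0r mulr0 addr0.
  have c'S : \sum_(n <- s) c' n * mmap1 z n = 0.
    have := congr1 (br (z b)) S0; rewrite (br0r brP) (brDr brP).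
    rewrite (brMr brP) cz mul0r add0r br_monomial.
    rewrite (drv_sum (br_along_r brP _)).
    have -> : \sum_(n <- s) br (z b) (c n * mmap1 z n) =
        z b * \sum_(n <- s) c n * e (wt b n) * mmap1 z n.
      rewrite mulr_sumr; apply: eq_bigr => n1 _.
      by rewrite (brMr brP) cz mul0r add0r br_monomial; ring.
    move=> S1; apply: (mulfI (z0 b)); rewrite mulr0 -[RHS]S1.
    have -> : c n0 * (e (wt b n0) * z b * mmap1 z n0) =
       - (z b * \sum_(n <- s) c n * e (wt b n0) * mmap1 z n).
      have -> : c n0 * (e (wt b n0) * z b * mmap1 z n0) =
        e (wt b n0) * z b * (c n0 * mmap1 z n0) by ring.
      move/eqP: S0; rewrite addr_eq0 => /eqP ->; rewrite mulrN -mulrA mulrCA; congr (- (_ * _)).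
      by rewrite mulr_sumr; apply: eq_bigr => n1 _; ring.
    rewrite addrC -mulrBr; congr (_ * _); rewrite -sumrB; apply: eq_bigr => n1 _.
    by rewrite /c' rmorphB /=; ring.
  have /eqP := IH c' us c'z c'S n ns; rewrite /c' mulf_eq0 fmorph_eq0 subr_eq0.
  by rewrite (negPf wb) orbF => /eqP.
move=> n; rewrite inE => /orP [/eqP ->|]; last exact: cs.
move: S0; rewrite big_seq big1 ?addr0 => [/eqP|n1 /cs ->]; last by rewrite mul0r.
rewrite mulf_eq0 => /orP [/eqP //|]; rewrite /mmap1 => /eqP /eqP.
by rewrite prodf_seq_eq0 => /hasP [i _ /=]; rewrite expf_eq0 (negPf (z0 i)) andbF.
Qed.

Lemma centre_independent (a : {mpoly Z[m]}) : mmap (val : {rmorphism Z -> F}) z a = 0 -> a = 0.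
Proof.
rewrite /mmap => a0; apply/mpolyP=> n; rewrite mcoeff0.
case: (boolP (n \in msupp a)) => [na|/memN_msupp_eq0 //].
apply: val_inj; rewrite rmorph0.
apply: (monomials_independent (c := fun n => val a@_n) (msupp_uniq a)) => //.
by move=> n1 y; apply: br_centre.
Qed.

End Independence.

Theorem log_canonical_rational m (y : 'I_m -> F) (mu : 'M[k]_m) : mu^T = - mu ->
  (forall i j, br (y i) (y j) = e (mu i j) * y i * y j) -> generates e y ->
  exists (K : fieldType) (iota : {rmorphism k -> K}) (n : nat) (nu : 'M[k]_n),
    nu^T = - nu /\ exists f : F -> {fraction {mpoly K[n]}},
      poisson_kiso e (fun c => ((iota c)%:MP)%:F) br (qtorus_br iota nu) f.
Proof.
move=> muT yy gen.
have /log_canonical_normalize [n [z [nu [zP z0 nd]]]] : log_canonical y mu.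
  split=> // S Sc SD SM SV Sy; apply: (gen S) => // c.
  exact: (Sc (to_centre brP bre c)).
exists Z, (to_centre brP bre), n, nu; have [nuT zz zgen] := zP; split=> //.
have [||||f [fb fD fM fE fB]] := @rational_iso Z F n (val : {rmorphism Z -> F}) z br
   (qtorus_gen (to_centre brP bre) nu) brP.
- by move=> c x; apply: br_centre.
- by move=> i j; rewrite mmap_qtorus_gen zz.
- exact: zgen.
- exact: (centre_independent zP z0 nd).
by exists f; split=> // c; rewrite -fE.
Qed.

End LogCanonical.

(** * Fraction fields of Poisson prime quotients *)

Lemma pbr_bracket (k : comNzRingType) N (B : 'I_N -> 'I_N -> {mpoly k[N]}) :
  (forall i j, B i j = - B j i) -> poisson_bracket (pbr B).
Proof.
move=> BN; split=> [x y z|x y z|x y]; last exact: pbr_flip.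
  by rewrite !pbrE derD.
by rewrite !pbrE derM.
Qed.

Section OreQuotient.
Local Open Scope quotient_scope.
Variables (k : fieldType) (N : nat) (B : 'I_N -> 'I_N -> {mpoly k[N]}).
Variables (r : 'I_N -> nat) (w : 'I_N -> 'I_N -> k).
Variable P : prime_idealr {mpoly k[N]}.
Hypothesis k0 : [pchar k] =i pred0.
Hypothesis oreP : poisson_ore B r w.
Hypothesis PP : poisson_ideal (pbr B) P.

Local Notation A := {mpoly k[N]}.
Local Notation pr := (\pi_({ideal_quot P})).
Local Notation F := {fraction {ideal_quot P}}.

Definition frac_pr : A -> F := @FracField.tofrac _ \o pr.
HB.instance Definition _ := GRing.RMorphism.copy frac_pr (@FracField.tofrac _ \o pr).

Definition frac_scalar : k -> F := frac_pr \o @mpolyC N k.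
HB.instance Definition _ := GRing.RMorphism.copy frac_scalar (frac_pr \o @mpolyC N k).

Local Notation br := (fbr (@qbr _ P (pbr B))).
Local Notation y := (fun i => frac_pr 'X_i).

Lemma frac_prE a : mmap frac_scalar y a = frac_pr a.
Proof.
elim/mpoly_alg_ind: a => [c|i|p q IHp IHq|p q IHp IHq].
- by rewrite mmapC.
- by rewrite mmapX mmap1U.
- by rewrite mmapD IHp IHq rmorphD.
- by rewrite !rmorphM /= IHp IHq.
Qed.

Lemma qbr_pbr_bracket : poisson_bracket (@qbr _ P (pbr B)).
Proof. exact: qbr_bracket (pbr_bracket (po_anti oreP)) PP. Qed.

Lemma frac_br_bracket : poisson_bracket br.
Proof. exact: fbr_bracket qbr_pbr_bracket. Qed.

Lemma frac_br_pr a b : br (frac_pr a) (frac_pr b) = frac_pr (pbr B a b).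
Proof.
rewrite /frac_pr /= (fbr_tofrac qbr_pbr_bracket); congr (_%:F).
exact: qbr_pi (pbr_bracket (po_anti oreP)) PP _ _.
Qed.

Lemma frac_br_gen i j : br (y i) (y j) = mmap frac_scalar y (B i j).
Proof. by rewrite frac_br_pr frac_prE pbrE derX derX. Qed.

Lemma frac_br_scalar c x : br x (frac_scalar c) = 0.
Proof.
rewrite (brC frac_br_bracket) fbrE.
have E0 z : frac_deriv (fun a => (@qbr _ P (pbr B) (pr c%:MP) a)%:F) z = 0.
  rewrite /frac_deriv -[\n_(repr z)]reprK -[\d_(repr z)]reprK.
  rewrite !(qbr_pi (pbr_bracket (po_anti oreP)) PP) !pbrE !derC.
  by rewrite !rmorph0 mulr0 subrr mul0r.
rewrite frac_deriv_tofrac ?E0 ?oppr0 //.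
have bP := qbr_pbr_bracket.
rewrite /frac_deriv; split=> a b.
  by rewrite !(brDl bP) !rmorphD /=; ring.
by rewrite !(brMl bP) !rmorphD !rmorphM /=; ring.
Qed.

Lemma frac_generated : generates frac_scalar y.
Proof.
move=> S Se SD SM SV Sy.
have Spr q : S q%:F.
  rewrite -[q]reprK -[_%:F]/(frac_pr (repr q)) -frac_prE.
  elim/mpoly_alg_ind: (repr q) => [c|i|p p' IHp IHq|p p' IHp IHq].
  - by rewrite mmapC; apply: Se.
  - by rewrite mmapX mmap1U; apply: Sy.
  - by rewrite mmapD; apply: SD.
  - by rewrite rmorphM; apply: SM.
by move=> x; rewrite (fracE x); apply: SM => //; apply: SV.
Qed.

Section ZeroIdeal.
Hypothesis P0 : forall a, (a \in P) = (a == 0).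

Lemma repr_pr a : repr (pr a) = a.
Proof.
apply/eqP; rewrite -subr_eq0 -P0.
by rewrite Quotient.idealrBE reprK.
Qed.

(** With P = 0 the quotient is A itself through [repr]; the partial derivatives are transported to
    it and extended by the quotient rule. *)
Lemma frac_partial : exists d : 'I_N -> F -> F, [/\
  forall i, derivation_along idfun (d i), forall i c, d i (frac_scalar c) = 0 &
  forall i l, d i (y l) = (i == l)%:R].
Proof.
pose E i (q : {ideal_quot P}) : F := frac_pr (mderiv i (repr q)).
have EP i : derivation_along (@FracField.tofrac _) (E i).
  split=> a b; rewrite -[a]reprK -[b]reprK; move: (repr a) (repr b) => {a b} a b.
    by rewrite -[pr a + pr b]rmorphD /E !repr_pr mderivD rmorphD.
  by rewrite -[pr a * pr b]rmorphM /E !repr_pr mderivM rmorphD !rmorphM.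
exists (fun i => frac_deriv (E i)); split=> [i|i c|i l].
- exact: frac_deriv_along.
- by rewrite frac_deriv_tofrac // /E repr_pr mderivC rmorph0.
by rewrite frac_deriv_tofrac // /E repr_pr mderivXU rmorph_nat.
Qed.

End ZeroIdeal.

Theorem ore_fraction_rational :
  (exists (K : fieldType) (iota : {rmorphism k -> K}) (m : nat) (mu : 'M[k]_m),
     mu^T = - mu /\
     exists f : {fraction {ideal_quot P}} -> {fraction {mpoly K[m]}},
       poisson_kiso (frac_quot_emb P) (fun c => ((iota c)%:MP)%:F)
         (fbr (@qbr _ P (pbr B))) (qtorus_br iota mu) f)
  /\
  ((forall a, (a \in P) = (a == 0)) ->
   exists mu : 'M[k]_N,
     mu^T = - mu /\
     exists f : {fraction {ideal_quot P}} -> {fraction {mpoly k[N]}},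
       poisson_kiso (frac_quot_emb P) (fun c => (c%:MP)%:F)
         (fbr (@qbr _ P (pbr B))) (qtorus_br id mu) f).
Proof.
have brP := frac_br_bracket; have bre := frac_br_scalar.
have [z [mu [muT zz gen]]] := deletion_algorithm k0 oreP brP bre frac_br_gen frac_generated.
split; first exact: (log_canonical_rational k0 brP bre muT zz gen).
move=> P0; exists mu; split=> //.
have [d [dP de dx]] := frac_partial P0.
have ind := generators_alg_independent k0 dP de dx gen.
have zB i j : br (z i) (z j) = mmap frac_scalar z (qtorus_gen id mu i j).
  by rewrite mmap_qtorus_gen zz.
have [f [fb fD fM fE fB]] := rational_iso brP bre zB gen ind.
by exists f; split.
Qed.

End OreQuotient.

(** * The six families *)

Section IndexedOre.
Variables (k : fieldType) (I : finType).
Local Notation A := {mpoly k[#|I|]}.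
Local Notation X := (@Xg k I).

Definition derI (v : I -> A) : A -> A := der (fun i => v (enum_val i)).

Lemma derIX v a : derI v (X a) = v a.
Proof. by rewrite /derI derX enum_rankK. Qed.

Lemma derIC v c : derI v c%:MP = 0. Proof. exact: derC. Qed.

Lemma derID v f g : derI v (f + g) = derI v f + derI v g. Proof. exact: derD. Qed.

Lemma derIN v f : derI v (- f) = - derI v f. Proof. exact: derN. Qed.

Lemma derIM v f g : derI v (f * g) = derI v f * g + f * derI v g.
Proof. exact: derM. Qed.

Lemma derICM v c f : derI v (c%:MP * f) = c%:MP * derI v f. Proof. exact: derCM. Qed.

Lemma derI0 v : derI v 0 = 0. Proof. exact: der0. Qed.

Lemma derI_bilinear v c1 c2 x1 z1 x2 z2 :
  derI v (c1%:MP * X x1 * X z1 + c2%:MP * X x2 * X z2) =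
  c1%:MP * (v x1 * X z1 + X x1 * v z1) + c2%:MP * (v x2 * X z2 + X x2 * v z2).
Proof.
rewrite derID -!mulrA !derICM (derIM v (X x1)) (derIM v (X x2)).
by rewrite (derIX v x1) (derIX v x2) (derIX v z1) (derIX v z2).
Qed.

Lemma mderivXg c a : mderiv (enum_rank c) (X a) = (c == a)%:R.
Proof. by rewrite mderivXU (inj_eq enum_rank_inj). Qed.

Definition locally_nilpotent_at (d : A -> A) (x : A) : Prop := exists m, iter m d x = 0.

Section Nilpotent.
Variable v : I -> A.
Local Notation nil := (locally_nilpotent_at (derI v)).

Lemma iter_derI0 m : iter m (derI v) 0 = 0.
Proof. by elim: m => //= m ->; apply: der0. Qed.

Lemma nil_step x : nil (derI v x) -> nil x.
Proof. by case=> m mx; exists m.+1; rewrite iterSr. Qed.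

Lemma nil_zero x : derI v x = 0 -> nil x.
Proof. by move=> dx; exists 1%N. Qed.

Lemma nilD x z : nil x -> nil z -> nil (x + z).
Proof.
case=> m mx [n nz]; exists (n + m)%N.
have iD q : iter q (derI v) (x + z) = iter q (derI v) x + iter q (derI v) z.
  by elim: q => //= q ->; apply: derD.
by rewrite iD iterD mx iter_derI0 add0r addnC iterD nz iter_derI0.
Qed.

(** Induction on the sum of the two exponents: each term of the Leibniz rule lowers one of them. *)
Lemma nilM x z : nil x -> nil z -> nil (x * z).
Proof.
case=> m + [n]; have [q] := ubnP (m + n).
elim: q m n x z => // q IH [|m] [|n] x z mnq /=.
- by move=> -> _; exists 0%N; rewrite /= mul0r.
- by move=> -> _; exists 0%N; rewrite /= mul0r.
- by move=> _ ->; exists 0%N; rewrite /= mulr0.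
rewrite -!iterS !iterSr => mx nz; apply: nil_step; rewrite /derI derM; apply: nilD.
  apply: (IH m n.+1) => //; last by rewrite iterSr.
by apply: (IH m.+1 n); rewrite ?iterSr //; move: mnq; rewrite addnS.
Qed.

Lemma nilC c : nil c%:MP.
Proof. by apply: nil_zero; apply: derC. Qed.

End Nilpotent.

Variables (Bg : I -> I -> A) (r : I -> nat) (w : I -> I -> k).

Definition lowI (b a : I) : A := Bg b a - (w b a)%:MP * X b * X a.

Definition deltaI (b : I) : A -> A := derI (fun a => if (r a < r b)%N then lowI b a else 0).

Lemma poisson_ore_indexed :
  injective r -> (forall a b, Bg a b = - Bg b a) ->
  (forall a b c, derI (Bg a) (Bg b c) + derI (Bg b) (Bg c a) + derI (Bg c) (Bg a b) = 0) ->
  (forall l a b, derI (fun i => (w l i)%:MP * X i) (Bg a b) = (w l a + w l b)%:MP * Bg a b) ->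
  (forall a b c, (r a < r b)%N -> (r b <= r c)%N -> mderiv (enum_rank c) (lowI b a) = 0) ->
  (forall a b, (r a < r b)%N -> locally_nilpotent_at (deltaI b) (X a)) ->
  (forall b, w b b != 0 \/ forall a, (r a < r b)%N -> lowI b a = 0) ->
  poisson_ore (liftB Bg) (fun i => r (enum_val i))
     (fun i j => w (enum_val i) (enum_val j)).
Proof.
move=> rI BN BJ BW Bi Bn Bs.
have XE i : 'X_i = X (enum_val i) :> A by rewrite /Xg enum_valK.
have lowE i j : low_part (liftB Bg) (fun i j => w (enum_val i) (enum_val j)) j i =
    lowI (enum_val j) (enum_val i).
  by rewrite /low_part !XE.
split.
- by move=> i j /rI; apply: enum_val_inj.
- by move=> i j; apply: BN.
- by move=> a b c; apply: BJ.
- move=> l a b; rewrite -[RHS]BW; apply: eq_der => i.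
  by rewrite XE.
- by move=> i j c ij jc; rewrite lowE -[c]enum_valK; apply: Bi.
- move=> i j ij; have [m mi] := Bn _ _ ij; exists m; rewrite XE -[RHS]mi.
  elim: m {mi} => //= m ->; apply: eq_der => a.
  by rewrite lowE.
move=> j; have [wj|lj] := Bs (enum_val j); [by left | right=> i ij].
by rewrite lowE; apply: lj.
Qed.

End IndexedOre.

Lemma anti_diag (k : fieldType) n (q : 'M[k]_n) i :
  [pchar k] =i pred0 -> q^T = - q -> q i i = 0.
Proof.
move=> k0 /(anti_entry i i) => qi.
have /eqP : q i i * 2%:R = 0 by rewrite mulr_natr mulr2n {1}qi addNr.
by rewrite mulf_eq0 (negPf (natS_neq0 k0 1)) orbF => /eqP.
Qed.

Lemma ore_affine_space (k : fieldType) n (q : 'M[k]_n) :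
  q^T = - q -> exists r w, poisson_ore (liftB (B_i q)) r w.
Proof.
move=> qT; have qN a b := anti_entry a b qT.
do 2 eexists; apply: (@poisson_ore_indexed _ _ (B_i q) val q).
- exact: val_inj.
- by move=> a b; rewrite /B_i qN rmorphN /=; ring.
- move=> a b c; rewrite /B_i !derIM !derIC !derIX.
  by rewrite (qN a b) (qN a c) (qN b c) !rmorphN /=; ring.
- by move=> l a b; rewrite /B_i !derIM !derIC !derIX rmorphD /=; ring.
- by move=> a b c _ _; rewrite /lowI /B_i subrr mderiv0.
- move=> a b ab; apply: nil_zero; rewrite /deltaI derIX ab.
  by rewrite /lowI /B_i subrr.
by move=> b; right=> a _; rewrite /lowI /B_i subrr.
Qed.

Lemma sgnkC (k : fieldType) n (a b : 'I_n) : sgnk k b a = - sgnk k a b.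
Proof.
by rewrite /sgnk -val_eqE -(val_eqE a b); case: (ltngtP a b) => _; rewrite ?oppr0 ?opprK.
Qed.

Lemma sgnk_lt (k : fieldType) n (a b : 'I_n) : (a < b)%N -> sgnk k a b = -1.
Proof. by rewrite /sgnk -val_eqE; case: ltngtP. Qed.

Lemma sgnk_gt (k : fieldType) n (a b : 'I_n) : (b < a)%N -> sgnk k a b = 1.
Proof. by rewrite /sgnk => ->. Qed.

Lemma sgnkk (k : fieldType) n (a : 'I_n) : sgnk k a a = 0.
Proof. by rewrite /sgnk ltnn eqxx. Qed.

(** The modified Yang-Baxter equation for the sign function. The Jacobiators of the matrix families
    are combinations of differences of two such sums, so only coinciding triples of indices need
    separate care. *)
Lemma sgnk_triple (k : fieldType) n (a b c : 'I_n) : ~~ ((a == b) && (b == c)) ->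
  sgnk k a b * sgnk k b c + sgnk k b c * sgnk k c a + sgnk k c a * sgnk k a b = -1.
Proof.
rewrite /sgnk -!val_eqE.
case: (ltngtP a b) => ab; case: (ltngtP b c) => bc; case: (ltngtP c a) => ca //=;
  try (by move: (ltn_trans ab bc); rewrite ltnNge (ltnW ca));
  try (by move: (ltn_trans bc ab); rewrite ltnNge (ltnW ca));
  try lia; move=> _; ring.
Qed.

(** * Family (ii): Poisson matrices *)

Section QuantumMatrices.
Variables (k : fieldType) (n : nat) (p : 'M[k]_n) (lam : k).
Hypothesis k0 : [pchar k] =i pred0.
Hypothesis pT : p^T = - p.
Local Notation I := ('I_n * 'I_n)%type.
Local Notation X := (@Xg k I).
Local Notation B := (B_ii p lam).
Local Notation h := (lam / 2%:R).
Local Notation s := (sgnk k).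

Lemma add_halves : lam = h + h.
Proof. by field; rewrite (natS_neq0 k0 1). Qed.

(* The standard (Sklyanin) bracket twisted by a log-canonical one; this form *)
(* needs no ordering of the two generators.                                  *)
Lemma B_iiE a i b j : B (a, i) (b, j) =
  (p a b + h * s a b + p j i + h * s j i)%:MP * X (a, i) * X (b, j)
  + (h * (s a b + s i j))%:MP * X (a, j) * X (b, i).
Proof.
have pN x z := anti_entry x z pT; have p0 x := anti_diag x k0 pT.
rewrite /B_ii /lexgt /B_ii_core /= -!val_eqE /=.
have := add_halves; move: h => h0 ->.
case: (ltngtP a b) => [ab|ba|/val_inj <-];
 case: (ltngtP i j) => [ij|ji|/val_inj <-] /=;
 rewrite ?sgnkk ?p0 ?(sgnk_lt k ab) ?(sgnk_gt k ab) ?(sgnk_lt k ba) ?(sgnk_gt k ba)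
   ?(sgnk_lt k ij) ?(sgnk_gt k ij) ?(sgnk_lt k ji) ?(sgnk_gt k ji);
 rewrite ?(pN b a) ?(pN i j); ring.
Qed.

Lemma B_ii_anti u v : B u v = - B v u.
Proof.
case: u v => [a i] [b j]; rewrite !B_iiE (anti_entry a b pT) (anti_entry i j pT).
by rewrite (sgnkC k a b) (sgnkC k i j); ring.
Qed.

(** The Jacobiator is h^2 (S - T) times a difference of two cubic monomials, with S built from the
    row indices and T from the column indices. Either S = T = -1, or one triple is constant and the
    two monomials coincide. *)
Lemma B_ii_jacobi u v t :
  derI (B u) (B v t) + derI (B v) (B t u) + derI (B t) (B u v) = 0.
Proof.
case: u v t => [a i] [b j] [c l].
pose S := s a b * s b c + s b c * s c a + s c a * s a b.
pose T := s i j * s j l + s j l * s l i + s l i * s i j.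
transitivity ((h ^+ 2 * (S - T))%:MP *
   (X (a, l) * X (b, i) * X (c, j) - X (a, j) * X (b, l) * X (c, i))).
  rewrite (B_iiE b j c l) (B_iiE c l a i) (B_iiE a i b j) !derI_bilinear !B_iiE /S /T.
  rewrite (sgnkC k a b) (sgnkC k b c) (sgnkC k c a).
  rewrite (sgnkC k i j) (sgnkC k j l) (sgnkC k l i).
  rewrite (anti_entry a b pT) (anti_entry b c pT) (anti_entry c a pT).
  rewrite (anti_entry i j pT) (anti_entry j l pT) (anti_entry l i pT).
  by move: h => h0; ring.
case: (boolP ((a == b) && (b == c))) => [/andP [/eqP <- /eqP <-]|abc].
  by ring.
case: (boolP ((i == j) && (j == l))) => [/andP [/eqP <- /eqP <-]|ijl].
  by ring.
by rewrite /S /T !sgnk_triple // subrr mulr0 mpolyC0 mul0r.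
Qed.

(** Read off from {X_u, X_v} with v below u and continued by the same formula, which makes the
    diagonal entry equal to [lam]. In v it is a function of the row plus a function of the column,
    so the two monomials of each bracket have the same weight. *)
Definition w_ii (u v : I) : k :=
  p u.1 v.1 + p v.2 u.2 + (if (u.2 <= v.2)%N then lam else 0).

Definition rank_lex (u : I) : nat := (u.1 * n + u.2)%N.

Lemma ltn_rank_lex u v :
  (rank_lex u < rank_lex v)%N = (u.1 < v.1)%N || ((u.1 == v.1) && (u.2 < v.2)%N).
Proof.
case: u v => [a i] [b j]; rewrite /rank_lex /= -val_eqE /=.
have := ltn_ord i; have := ltn_ord j.
case: (ltngtP a b) => [ab|ba|->] jn in_ /=; [| |by rewrite ltn_add2l].
  have : (a.+1 * n <= b * n)%N by rewrite leq_mul2r ab orbT.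
  by rewrite mulSn; lia.
have : (b.+1 * n <= a * n)%N by rewrite leq_mul2r ba orbT.
by rewrite mulSn; lia.
Qed.

Lemma rank_lex_inj : injective rank_lex.
Proof.
move=> u v uv; have := ltn_rank_lex u v; have := ltn_rank_lex v u.
rewrite uv ltnn; case: u v {uv} => [a i] [b j] /=; rewrite -!val_eqE /=.
case: (ltngtP a b) => [||/val_inj ->] //=.
by case: (ltngtP i j) => [||/val_inj ->].
Qed.

Lemma low_ii a i b j : (rank_lex (a, i) < rank_lex (b, j))%N ->
  lowI B w_ii (b, j) (a, i) =
  (if (a < b)%N && (i < j)%N then lam%:MP * X (a, j) * X (b, i) else 0).
Proof.
rewrite ltn_rank_lex /= -val_eqE /= /lowI /w_ii /= /B_ii /lexgt /=.
case: (ltngtP a b) => [ab|ba|/val_inj <-] //=.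
  by move=> _; case: (ltnP i j) => ij /=; ring.
by rewrite eqxx /= => ij; rewrite (leqNgt j i) ij (anti_diag a k0 pT) /=; ring.
Qed.

Lemma ore_quantum_matrices : exists r w, poisson_ore (liftB B) r w.
Proof.
do 2 eexists; apply: (@poisson_ore_indexed _ _ B rank_lex w_ii).
- exact: rank_lex_inj.
- exact: B_ii_anti.
- exact: B_ii_jacobi.
- move=> [l m] [a i] [b j]; rewrite B_iiE derI_bilinear /w_ii /=.
  rewrite !rmorphD /=; move: h => h0.
  by case: (m <= i)%N; case: (m <= j)%N; ring.
- move=> [a i] [b j] c ab bc; rewrite low_ii //; case: ifP => [/andP [ab' ij]|_].
    have lt u : (rank_lex u < rank_lex (b, j))%N -> mderiv (enum_rank c) (X u) = 0.
      move=> ub; rewrite mderivXg; case: eqP => // cu.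
      by move: bc; rewrite cu leqNgt ub.
    rewrite !mderivM mderivC !lt; first by ring.
      by rewrite ltn_rank_lex /= eqxx ij orbT.
    by rewrite ltn_rank_lex /= ab'.
  exact: mderiv0.
- move=> [a i] [b j] ab; apply: nil_step; rewrite derIX ab low_ii //.
  case: ifP => [/andP [ab' ij]|_]; last by exists 0%N.
  (* delta_(b,j) sends X_(a,i) to [lam] X_(a,j) X_(b,i); both factors lie in column j or row b, and
     such variables are killed. *)
  have nX (u : I) : ~~ ((u.1 < b)%N && (u.2 < j)%N) ->
      locally_nilpotent_at (deltaI B rank_lex w_ii (b, j)) (X u).
    case: u => [a' i'] /= /negPf ua; apply: nil_zero; rewrite derIX; case: ifP => // ub.
    by rewrite low_ii // ua.
  apply: nilM; [apply: nilM; [exact: nilC|]|]; apply: nX; rewrite /= ltnn ?andbF //.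
move=> [b j]; rewrite /w_ii /= !(anti_diag _ k0 pT) leqnn !add0r.
case: (eqVneq lam 0) => [l0|]; [right | by left].
move=> [a i] ab; rewrite low_ii // l0 mpolyC0 !mul0r; by case: ifP.
Qed.

End QuantumMatrices.

(** * Families (v) and (vi): symmetric and antisymmetric matrices, with e = 1 or -1 *)

Section ReflectionBracket.
Variables (R : comPzRingType) (T : Type) (e : R) (s y : T -> T -> R).
Hypothesis e1 : e = 1 \/ e = -1.
Hypothesis sC : forall a b, s b a = - s a b.
Hypothesis yC : forall a b, y b a = e * y a b.

Definition refl_br i j l m : R :=
  (s l j + s m i) * y i l * y j m + e * (s l i + s m j) * y i m * y j l.

Definition refl_br_leibniz i j l m r t : R :=
  (s r m + s t l) * (refl_br i j l r * y m t + y l r * refl_br i j m t)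
  + e * (s r l + s t m) * (refl_br i j l t * y m r + y l t * refl_br i j m r).

Lemma refl_br_flip i j l m : refl_br i j m l = e * refl_br i j l m.
Proof. by case: e1 => e1'; rewrite /refl_br e1'; ring. Qed.

Lemma refl_br_anti i j l m : refl_br i j l m = - refl_br l m i j.
Proof.
rewrite /refl_br (yC i l) (yC j m) (yC i m) (yC j l).
rewrite (sC i l) (sC j m) (sC i m) (sC j l).
by case: e1 => ->; ring.
Qed.

Local Notation S3 a b c := (s a b * s b c + s b c * s c a + s c a * s a b).

(** Each cubic factor is arranged to vanish when one of the two index triples in front of it is
    constant; otherwise the two sums of sign products agree. *)
Lemma refl_br_jacobi i j l m r t :
  refl_br_leibniz i j l m r t + refl_br_leibniz l m r t i j + refl_br_leibniz r t i j l m =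
  (S3 i l r - S3 j m t) * (y i t * y j l * y m r - e * y i m * y j r * y l t)
  + (S3 i l t - S3 j m r) * (e * y i r * y j l * y m t - y i m * y j t * y l r)
  + (S3 i m r - S3 j l t) * (e * y i t * y j m * y l r - y i l * y j r * y m t)
  + (S3 i m t - S3 j l r) * (y i r * y j m * y l t - e * y i l * y j t * y m r).
Proof.
rewrite /refl_br_leibniz /refl_br.
rewrite (yC i l) (yC j m) (yC i m) (yC j l) (yC i r) (yC i t) (yC j r) (yC j t).
rewrite (yC l r) (yC l t) (yC m r) (yC m t).
rewrite (sC i l) (sC j m) (sC i m) (sC j l) (sC i r) (sC i t) (sC j r) (sC j t).
rewrite (sC l r) (sC l t) (sC m r) (sC m t).
by case: e1 => ->; ring.
Qed.

End ReflectionBracket.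

Section ReflectionOre.
Variables (k : fieldType) (n : nat) (I : finType) (pv : I -> 'I_n * 'I_n).
Local Notation A := {mpoly k[#|I|]}.
Local Notation X := (@Xg k I).
Variables (eps : k) (y : 'I_n -> 'I_n -> A) (B : I -> I -> A).
Local Notation s := (sgnk k).
Local Notation sA := (fun a b : 'I_n => (s a b)%:MP : A).
Local Notation F := (refl_br (eps%:MP) sA y).
Hypothesis k0 : [pchar k] =i pred0.
Hypothesis eps1 : eps = 1 \/ eps = -1.
Hypothesis pvI : injective pv.
Hypothesis pv_le : forall u, ((pv u).1 <= (pv u).2)%N.
Hypothesis yC : forall a b, y b a = eps%:MP * y a b.
Hypothesis yX : forall u, y (pv u).1 (pv u).2 = X u.
Hypothesis y_cases : forall a b : 'I_n, (a <= b)%N ->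
  (exists u, pv u = (a, b)) \/ [/\ a = b, eps = -1 & y a a = 0].
Hypothesis BE : forall u v, B u v = F (pv u).1 (pv u).2 (pv v).1 (pv v).2.

Let epsM1 : (eps%:MP : A) = 1 \/ (eps%:MP : A) = -1.
Proof.
by case: eps1 => ->; [left; rewrite rmorph1 | right; rewrite rmorphN rmorph1].
Qed.

Let sC (a b : 'I_n) : (s b a)%:MP = - (s a b)%:MP :> A.
Proof. by rewrite sgnkC rmorphN. Qed.

(** Reduces statements about all pairs of indices to the generators; the third premise covers the
    zero diagonal of antisymmetric matrices. *)
Lemma y_ind (T : 'I_n -> 'I_n -> Prop) :
  (forall u, T (pv u).1 (pv u).2) -> (forall a b, T a b -> T b a) ->
  (forall a, eps = -1 -> y a a = 0 -> T a a) -> forall a b, T a b.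
Proof.
move=> TX TC T0; have Tle (a b : 'I_n) : (a <= b)%N -> T a b.
  by case/y_cases => [[u uE]|[-> *]]; [have := TX u; rewrite uE | apply: T0].
by move=> a b; case: (leqP a b) => [|/ltnW] /Tle //; apply: TC.
Qed.

Lemma derI_By u a b : derI (B u) (y a b) = F (pv u).1 (pv u).2 a b.
Proof.
move: a b; apply: y_ind => [v|a b H|a eN y0].
- by rewrite yX derIX BE.
- by rewrite yC derICM H [RHS](refl_br_flip sA y epsM1).
by rewrite y0 derI0 /refl_br eN rmorphN rmorph1; ring.
Qed.

Lemma derI_F v i j l m : derI v (F i j l m) =
  ((s l j)%:MP + (s m i)%:MP) * (derI v (y i l) * y j m + y i l * derI v (y j m))
  + eps%:MP * ((s l i)%:MP + (s m j)%:MP)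
    * (derI v (y i m) * y j l + y i m * derI v (y j l)).
Proof.
rewrite /refl_br derID -2!rmorphD -rmorphM -!mulrA !derICM.
by rewrite (derIM v (y i l)) (derIM v (y i m)).
Qed.

Lemma refl_jacobi u v t : derI (B u) (B v t) + derI (B v) (B t u) + derI (B t) (B u v) = 0.
Proof.
rewrite !BE !derI_F !derI_By.
move: (pv u) (pv v) (pv t) => [i j] [l m] [r q] /=.
apply: etrans (refl_br_jacobi epsM1 sC yC i j l m r q) _.
have vanish a b c a' b' c' (C : A) : (a = b -> b = c -> C = 0) ->
    (a' = b' -> b' = c' -> C = 0) ->
    ((s a b)%:MP * (s b c)%:MP + (s b c)%:MP * (s c a)%:MP + (s c a)%:MP * (s a b)%:MP
    - ((s a' b')%:MP * (s b' c')%:MP + (s b' c')%:MP * (s c' a')%:MP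
       + (s c' a')%:MP * (s a' b')%:MP)) * C = 0.
  move=> C1 C2; rewrite -!rmorphM -!rmorphD -rmorphB /=.
  case: (boolP ((a == b) && (b == c))) => [/andP [/eqP ab /eqP bc]|abc].
    by rewrite C1 ?mulr0.
  case: (boolP ((a' == b') && (b' == c'))) => [/andP [/eqP ab' /eqP bc']|abc'].
    by rewrite C2 ?mulr0.
  by rewrite !sgnk_triple // subrr mpolyC0 mul0r.
rewrite !vanish ?addr0 //; move=> <- <-;
  first [rewrite (yC i m) | rewrite (yC j l) | rewrite (yC i l) | rewrite (yC j m)];
  by case: epsM1 => ->; ring.
Qed.

Definition refl_wt (v : I) (a : 'I_n) : k := (a == (pv v).1)%:R + (a == (pv v).2)%:R.

(** Weights of the torus action in which y_ab is multiplied by t_a t_b. The diagonal entries are -2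
    off the diagonal of the matrix and -4 on it, hence nonzero in characteristic zero. *)
Definition w_refl (v u : I) : k := - (refl_wt v (pv u).1 + refl_wt v (pv u).2).

Lemma refl_weight_y v a b : derI (fun u => (w_refl v u)%:MP * X u) (y a b) =
  (- (refl_wt v a + refl_wt v b))%:MP * y a b.
Proof.
move: a b; apply: y_ind => [u|a b H|a _ y0].
- by rewrite yX derIX.
- by rewrite yC derICM H mulrCA (addrC (refl_wt v b)).
by rewrite y0 derI0 mulr0.
Qed.

Lemma refl_weight v a b : derI (fun u => (w_refl v u)%:MP * X u) (B a b) =
  (w_refl v a + w_refl v b)%:MP * B a b.
Proof.
rewrite BE derI_F !refl_weight_y /w_refl /refl_br !rmorphD !rmorphN !rmorphD /=.
by ring.
Qed.

Local Notation rk u := (rank_lex (pv u)).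
Local Notation low i j l m := (if (i < l)%N then
  (if (j < l)%N then (- 2%:R)%:MP * y i l * y j m else 0) +
  (if (j < m)%N then (- 2%:R)%:MP * y i m * y l j else 0) else 0).

Lemma low_refl u v : (rk u < rk v)%N ->
  lowI B w_refl v u = low (pv u).1 (pv u).2 (pv v).1 (pv v).2.
Proof.
rewrite ltn_rank_lex /lowI BE -(yX u) -(yX v) /w_refl /refl_wt.
move: (pv_le u) (pv_le v); move: (pv u) (pv v) => [i j] [l m] /=.
rewrite -!val_eqE /= => ij lm.
case: (ltngtP i l) => [il|li|/val_inj il] //= H.
  have im : (i < m)%N by apply: leq_trans lm.
  rewrite /refl_br (sgnk_lt k il) (sgnk_lt k im) (yC i l) (yC j m) (yC i m).
  rewrite (ltn_eqF im).
  case: (ltngtP j l) => [jl|lj|/val_inj jl].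
  - have jm : (j < m)%N by apply: leq_trans lm.
    rewrite (sgnk_lt k jl) (sgnk_lt k jm) jm ?(ltn_eqF jm).
    by case: eps1 => -> /=; ring.
  - rewrite (sgnk_gt k lj); case: (ltngtP j m) => [jm|mj|/val_inj jm].
    + by rewrite (sgnk_lt k jm); case: eps1 => -> /=; ring.
    + by rewrite (sgnk_gt k mj) /=; ring.
    + by rewrite -jm sgnkk; case: eps1 => -> /=; ring.
  rewrite jl sgnkk; case: (ltngtP l m) lm => [lm|//|/val_inj lm] _.
    by rewrite (sgnk_lt k lm); case: eps1 => -> /=; ring.
  by rewrite -lm sgnkk; case: eps1 => -> /=; ring.
subst i; have lm' : (l < m)%N by apply: leq_ltn_trans H.
rewrite /refl_br (sgnk_lt k lm') (sgnk_lt k H) sgnkk ?(ltn_eqF H) ?(ltn_eqF lm').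
rewrite (yC j m) (yC l m).
case: (ltngtP l j) ij => [lj|//|/val_inj jl] _.
  by rewrite (sgnk_gt k lj) ?(gtn_eqF lj); case: eps1 => -> /=; ring.
rewrite -jl sgnkk ?eqxx; case: eps1 => epsE; first by rewrite epsE /=; ring.
have -> : y l l = 0.
  apply: (mpoly_mulrnI k0 (m := 1)).
  by rewrite mul0rn mulr2n {1}yC epsE rmorphN rmorph1 mulN1r addNr.
by ring.
Qed.

Lemma y_free (a b : 'I_n) v c : (a <= b)%N -> (rank_lex (a, b) < rk v)%N ->
  (rk v <= rk c)%N -> mderiv (enum_rank c) (y a b) = 0.
Proof.
move=> /y_cases [[u uE] uv vc|[-> _ ->] _ _]; last exact: mderiv0.
have := yX u; rewrite uE /= => ->; rewrite mderivXg; case: eqP => // cu.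
by move: (leq_trans uv vc); rewrite cu uE ltnn.
Qed.

Lemma rank_lex_lt (a b l m : 'I_n) : (a < l)%N -> (rank_lex (a, b) < rank_lex (l, m))%N.
Proof. by rewrite ltn_rank_lex /= => ->. Qed.

Lemma rank_lex_eq (b l m : 'I_n) : (b < m)%N -> (rank_lex (l, b) < rank_lex (l, m))%N.
Proof. by rewrite ltn_rank_lex /= eqxx => ->; rewrite orbT. Qed.

Lemma refl_indep u v c : (rk u < rk v)%N -> (rk v <= rk c)%N ->
  mderiv (enum_rank c) (lowI B w_refl v u) = 0.
Proof.
move=> uv vc; rewrite low_refl //.
have free (a b : 'I_n) : (a <= b)%N -> (rank_lex (a, b) < rk v)%N ->
    mderiv (enum_rank c) (y a b) = 0.
  by move=> ab lt; apply: y_free lt vc.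
move: free (pv_le u) (pv_le v); move: (pv u) (pv v) => [i j] [l m] /= free ij lm.
case: ifP => il; last exact: mderiv0.
have freeM c1 (a b a' b' : 'I_n) : mderiv (enum_rank c) (y a b) = 0 ->
    mderiv (enum_rank c) (y a' b') = 0 ->
    mderiv (enum_rank c) (c1%:MP * y a b * y a' b') = 0.
  by move=> H1 H2; rewrite !mderivM mderivC H1 H2; ring.
have il' : (i <= l)%N by apply: ltnW.
have im' : (i <= m)%N by apply: leq_trans lm.
rewrite mderivD; case: ifP => jl; case: ifP => jm; rewrite ?mderiv0 ?addr0 ?add0r //.
- have jl' : (j <= l)%N by apply: ltnW.
  have jm' : (j <= m)%N by apply: ltnW.
  rewrite freeM ?add0r ?freeM //; try by apply: free => //; apply: rank_lex_lt.
  by rewrite (yC j l) mderiv_mulC free ?mulr0 //; apply: rank_lex_lt.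
- by rewrite freeM // free ?rank_lex_lt // (leq_trans (ltnW jl)).
apply: freeM; apply: free => //; first exact: rank_lex_lt.
  by rewrite leqNgt jl.
exact: rank_lex_eq.
Qed.

(** For v = (l,m), delta_v kills y_am with a < l ([N1]) and y_lb with l <= b < m ([N2]). It sends
    y_ab with a < l <= b to zero or a product of two such ([N3]), and y_lb with b < l is one of
    these up to sign ([N4]). The remaining y_ij, with i <= j < l, go to sums of products of all
    these. *)
Lemma refl_nil u v : (rk u < rk v)%N ->
  locally_nilpotent_at (deltaI B (fun u => rk u) w_refl v) (X u).
Proof.
move=> uv; pose nil := locally_nilpotent_at (deltaI B (fun u => rk u) w_refl v).
have step (a b : 'I_n) : (a <= b)%N -> (rank_lex (a, b) < rk v)%N ->
    nil (low a b (pv v).1 (pv v).2) -> nil (y a b).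
  move=> /y_cases [[t tE] tv nt|[-> _ ->] _ _]; last by exists 0%N.
  have := yX t; rewrite tE /= => ->; apply: nil_step.
  by rewrite derIX tE tv low_refl ?tE.
suff : nil (y (pv u).1 (pv u).2) by rewrite yX.
have n0 : nil 0 by exists 0%N.
have nM c1 x z : nil x -> nil z -> nil (c1%:MP * x * z).
  by move=> nx nz; apply: nilM => //; apply: nilM => //; apply: nilC.
move: uv step (pv_le u) (pv_le v); move: (pv u) (pv v) => [i j] [l m] /= uv step ij lm.
have N1 (a : 'I_n) : (a < l)%N -> nil (y a m).
  move=> al; apply: step; [exact: leq_trans (ltnW al) lm | exact: rank_lex_lt |].
  by rewrite al ltnn ltnNge lm addr0.
have N2 (b : 'I_n) : (l <= b)%N -> (b < m)%N -> nil (y l b).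
  by move=> lb bm; apply: step => //; [exact: rank_lex_eq | rewrite ltnn].
have N3 (a b : 'I_n) : (a < l)%N -> (l <= b)%N -> nil (y a b).
  move=> al lb; apply: step; [exact: leq_trans (ltnW al) lb | exact: rank_lex_lt |].
  rewrite al ltnNge lb add0r; case: ifP => // bm.
  by apply: nM; [apply: N1 | apply: N2].
have N4 (b : 'I_n) : (b < l)%N -> nil (y l b).
  by move=> bl; rewrite (yC b l); apply: nilM; [apply: nilC | apply: N3].
move: uv; rewrite ltn_rank_lex /= -val_eqE /=.
case: (ltngtP i l) => [il _|//|/val_inj il /= jm]; last by subst i; apply: N2.
case: (ltnP j l) => [jl|lj]; last exact: N3.
apply: step; [by [] | exact: rank_lex_lt | rewrite il jl; apply: nilD].
  by apply: nM; [apply: N3 | apply: N1].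
by case: ifP => _ //; apply: nM; [apply: N1 | apply: N4].
Qed.

Lemma refl_ore : exists r w, poisson_ore (liftB B) r w.
Proof.
do 2 eexists; apply: (@poisson_ore_indexed _ _ B (fun u => rk u) w_refl).
- by move=> u v /rank_lex_inj /pvI.
- by move=> u v; rewrite !BE (refl_br_anti epsM1 sC yC).
- exact: refl_jacobi.
- exact: refl_weight.
- exact: refl_indep.
- exact: refl_nil.
move=> v; left; rewrite /w_refl /refl_wt oppr_eq0 !eqxx (eq_sym (pv v).2) -!natrD.
by rewrite (pcharf0P k).1 //; case: eqP.
Qed.

End ReflectionOre.

Lemma ore_symmetric_matrices (k : fieldType) n : [pchar k] =i pred0 ->
  exists r w, poisson_ore (liftB (@B_v k n)) r w.
Proof.
move=> k0.
have yE (u : Isym n) : ysym k (val u).1 (val u).2 = Xg k u.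
  by rewrite /ysym (valP u) /yo_sym -surjective_pairing valK.
apply: (refl_ore (pv := val) (eps := 1) (y := @ysym k n)) => //.
- by left.
- exact: val_inj.
- by move=> u; apply: (valP u).
- move=> a b; rewrite mul1r /ysym; case: (ltngtP a b) => // /val_inj ->.
  by [].
- by move=> a b ab; left; exists (Sub (a, b) ab).
move=> u v; rewrite /B_v /refl_br; case: (val u) (val v) => [i j] [l m] /=.
by rewrite !rmorphD rmorph1 mul1r.
Qed.

Lemma ore_antisymmetric_matrices (k : fieldType) n : [pchar k] =i pred0 ->
  exists r w, poisson_ore (liftB (@B_vi k n)) r w.
Proof.
move=> k0.
have yE (u : Iasym n) : yasym k (val u).1 (val u).2 = Xg k u.
  by rewrite /yasym (valP u) /yo_asym -surjective_pairing valK.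
apply: (refl_ore (pv := val) (eps := -1) (y := @yasym k n)) => //.
- by right.
- exact: val_inj.
- by move=> u; apply: ltnW (valP u).
- move=> a b; rewrite rmorphN rmorph1 mulN1r /yasym.
  by case: (ltngtP a b) => //; rewrite ?oppr0 ?opprK.
- move=> a b; rewrite leq_eqVlt => /orP [/eqP /val_inj ->|ab]; last first.
    by left; exists (Sub (a, b) ab).
  by right; split=> //; rewrite /yasym ltnn.
move=> u v; rewrite /B_vi /refl_br; case: (val u) (val v) => [i j] [l m] /=.
by rewrite !rmorphD rmorphN rmorph1; ring.
Qed.

(** * Families (iii) and (iv): Poisson Weyl algebras and their homogenizations *)

Section WeylOre.
Variables (k : fieldType) (n : nat) (G : 'M[k]_n) (P Q : 'I_n -> k).
Variables (I : finType) (cl : I -> option ('I_n + 'I_n)) (emb : 'I_n + 'I_n -> I).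
Local Notation A := {mpoly k[#|I|]}.
Local Notation X := (@Xg k I).
Local Notation xx := (fun i => X (emb (inl i))).
Local Notation yy := (fun i => X (emb (inr i))).
Variables (lam : k) (E : A) (B : I -> I -> A).
Hypothesis k0 : [pchar k] =i pred0.
Hypothesis GT : G^T = - G.
Hypothesis PQ : forall i, P i != Q i.
Hypothesis clI : injective cl.
Hypothesis clE : forall a, cl (emb a) = Some a.
Hypothesis E_cases : E = 0 \/ exists2 z, cl z = None & E = lam%:MP * X z * X z.
Hypothesis Bweyl : forall a b, B (emb a) (emb b) = B_weyl G P Q xx yy E a b.

Definition half_weight (a : 'I_n + 'I_n) : k :=
  match a with inl i => - (P i / 2%:R) | inr i => P i / 2%:R end.

Hypothesis Bz : forall z a, cl z = None ->
  B z (emb a) = (half_weight a)%:MP * X z * X (emb a).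
Hypothesis Bz' : forall z a, cl z = None ->
  B (emb a) z = - ((half_weight a)%:MP * X z * X (emb a)).
Hypothesis Bzz : forall z, cl z = None -> B z z = 0.

(** The part of {x_i, y_i} that is not log-canonical. Passing from i to i+1 adds (q_i - p_i) x_i
    y_i. *)
Definition Omega (i : 'I_n) : A :=
  \sum_(l < n | (l < i)%N) (Q l - P l)%:MP * xx l * yy l + E.

Variant I_spec (u : I) : Type :=
  | I_x i of u = emb (inl i) | I_y i of u = emb (inr i) | I_z of cl u = None.

Lemma I_P u : I_spec u.
Proof.
case uE : (cl u) => [[i|i]|]; last exact: I_z.
  by apply: (@I_x _ i); apply: clI; rewrite clE.
by apply: (@I_y _ i); apply: clI; rewrite clE.
Qed.

Lemma z_uniq u v : cl u = None -> cl v = None -> u = v.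
Proof. by move=> uN vN; apply: clI; rewrite uN. Qed.

Definition paired (u v : I) : bool :=
  match cl u, cl v with
  | Some (inl i), Some (inr j) | Some (inr i), Some (inl j) => i == j
  | _, _ => false
  end.

Lemma B_x_y i : B (emb (inl i)) (emb (inr i)) = (Q i)%:MP * xx i * yy i + Omega i.
Proof. by rewrite Bweyl /= /br_xy ltnn addrA. Qed.

Lemma weyl_anti u v : B u v = - B v u.
Proof.
have G0 i := anti_diag i k0 GT; have GN a b := anti_entry a b GT.
case: (I_P u) => [i ->|i ->|uz]; case: (I_P v) => [j ->|j ->|vz];
  rewrite ?Bweyl ?Bz ?Bz' ?opprK //=.
- rewrite /br_xx; case: (ltngtP i j) => ij; rewrite ?oppr0 ?opprK //.
- by rewrite /br_yy (GN i j) rmorphN /=; ring.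
by rewrite (z_uniq vz uz) Bzz // oppr0.
Qed.

Definition log_pair (u v : I) : Prop := exists c : k, B u v = c%:MP * X u * X v.

(** Only the brackets of some x_i with y_i fail to be log-canonical; this confines the work in the
    Jacobi and weight identities to such pairs. *)
Lemma unpaired_log u v : ~~ paired u v -> log_pair u v.
Proof.
have sym a b : log_pair a b -> log_pair b a.
  by case=> c ab; exists (- c); rewrite weyl_anti ab rmorphN /=; ring.
have xy i j : ~~ paired (emb (inl i)) (emb (inr j)) -> log_pair (emb (inl i)) (emb (inr j)).
  rewrite /paired !clE -val_eqE /log_pair Bweyl /= /br_xy.
  by case: (ltngtP i j) => // _ _; eexists.
case: (I_P u) => [i ->|i ->|uz]; case: (I_P v) => [j ->|j ->|vz].
- move=> _; rewrite /log_pair Bweyl /= /br_xx; case: (ltngtP i j) => _; first by eexists.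
    by exists (- (Q j - P i + G j i)); rewrite rmorphN /=; ring.
  by exists 0; rewrite mpolyC0 !mul0r.
- exact: xy.
- by move=> _; apply: sym; eexists; apply: Bz.
- move=> uv; apply: sym; apply: xy; move: uv; rewrite /paired !clE eq_sym; by [].
- by move=> _; rewrite /log_pair Bweyl; eexists.
- by move=> _; apply: sym; eexists; apply: Bz.
- by move=> _; eexists; apply: Bz.
- by move=> _; eexists; apply: Bz.
by move=> _; exists 0; rewrite (z_uniq vz uz) Bzz // mpolyC0 !mul0r.
Qed.

Section Weights.

Definition w_weyl (u v : I) : k :=
  match cl u, cl v with
  | Some (inl l), Some (inl i) => - (Q i - P l + G i l)
  | Some (inl l), Some (inr i) => Q i + G i l
  | Some (inl l), None => P l / 2%:R
  | Some (inr l), Some (inl i) => - (P l + G l i)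
  | Some (inr l), Some (inr i) => G l i
  | Some (inr l), None => - (P l / 2%:R)
  | None, Some a => half_weight a
  | None, None => 0
  end.

(** The weights [w_weyl] are such that every product x_i y_i has this weight, whatever i, and so
    does the square of z; hence all [Omega i] are homogeneous. *)
Definition pair_weight (u : I) : k :=
  match cl u with Some (inl l) => P l | Some (inr l) => - P l | None => 0 end.

Local Notation alpha u := (derI (fun v => (w_weyl u v)%:MP * X v)).

Lemma alpha_pair u i : alpha u (xx i * yy i) = (pair_weight u)%:MP * (xx i * yy i).
Proof.
rewrite derIM !derIX.
have -> : pair_weight u = w_weyl u (emb (inl i)) + w_weyl u (emb (inr i)).
  by rewrite /pair_weight /w_weyl !clE; case: (cl u) => [[l|l]|] /=; ring.
by rewrite rmorphD /=; ring.
Qed.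

Lemma alpha_E u : alpha u E = (pair_weight u)%:MP * E.
Proof.
case: E_cases => [->|[z zN ->]]; first by rewrite derI0 mulr0.
rewrite -mulrA derICM derIM !derIX.
have -> : pair_weight u = w_weyl u z + w_weyl u z.
  rewrite /pair_weight /w_weyl zN; case: (cl u) => [[l|l]|]; last by rewrite addr0.
    by field; rewrite (natS_neq0 k0 1).
  by field; rewrite (natS_neq0 k0 1).
by rewrite rmorphD /=; ring.
Qed.

Lemma alpha_Omega u i : alpha u (Omega i) = (pair_weight u)%:MP * Omega i.
Proof.
rewrite /Omega derID alpha_E mulrDr; congr (_ + _).
rewrite /derI der_sum -/(derI _ _) mulr_sumr; apply: eq_bigr => l _.
by rewrite -mulrA -/(alpha u _) derICM alpha_pair; ring.
Qed.

Lemma weyl_weight u a b : alpha u (B a b) = (w_weyl u a + w_weyl u b)%:MP * B a b.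
Proof.
wlog: a b / log_pair a b \/ exists i, a = emb (inl i) /\ b = emb (inr i).
  move=> H; case: (boolP (paired a b)) => [ab|/unpaired_log ab]; last by apply: H; left.
  case: (I_P a) ab => [i ->|i ->|uz]; case: (I_P b) => [j ->|j ->|vz];
    rewrite /paired ?clE ?uz ?vz // => /eqP ->.
    by apply: H; right; exists j.
  by rewrite weyl_anti derIN H 1?addrC ?mulrN //; right; exists j.
case=> [[c ->]|[i [-> ->]]].
  by rewrite -mulrA derICM derIM !derIX rmorphD /=; ring.
have e : w_weyl u (emb (inl i)) + w_weyl u (emb (inr i)) = pair_weight u.
  by rewrite /pair_weight /w_weyl !clE; case: (cl u) => [[l|l]|] /=; ring.
by rewrite e B_x_y derID alpha_Omega -mulrA derICM alpha_pair; ring.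
Qed.

End Weights.

Section Jacobi.

(* Brackets with [x_j] (sign [1]) and with [y_j] (sign [-1]) are treated *)
(* together.                                                             *)
Lemma weyl_action j (t : I) (sg : k) :
  t = emb (inl j) /\ sg = 1 \/ t = emb (inr j) /\ sg = -1 ->
  [/\ forall l, l != j ->
        derI (B t) (xx l * yy l) =
        (sg * (if (j < l)%N then Q j else P j))%:MP * X t * (xx l * yy l),
      derI (B t) (xx j * yy j) = sg%:MP * X t * ((Q j)%:MP * (xx j * yy j) + Omega j)
    & derI (B t) E = (sg * P j)%:MP * X t * E].
Proof.
have G0 i := anti_diag i k0 GT; have GN a b := anti_entry a b GT.
have EP : derI (B t) E = (pair_weight t)%:MP * X t * E.
  case: E_cases => [->|[z zN ->]]; first by rewrite derI0 mulr0.
  rewrite -mulrA derICM derIM !derIX.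
  rewrite /pair_weight; case: (I_P t) => [i ->|i ->|tz].
  + rewrite Bz' // clE /=; have := add_halves (P i) k0.
    by move: (P i / 2%:R) => h ->; rewrite !rmorphN /=; ring.
  + rewrite Bz' // clE /=; have := add_halves (P i) k0.
    by move: (P i / 2%:R) => h ->; rewrite !rmorphN /=; ring.
  by rewrite ?tz (z_uniq tz zN) ?zN Bzz // mpolyC0; ring.
case=> [[tE ->]|[tE ->]]; rewrite {}EP /pair_weight tE clE; split.
- move=> l lj; rewrite derIM !derIX !Bweyl /= /br_xx /br_xy.
  move: lj; rewrite -val_eqE (GN l j); case: (ltngtP j l) => // jl _; rewrite ?mul1r;
  rewrite !rmorphD ?rmorphN /=; ring.
- rewrite derIM !derIX B_x_y Bweyl /= /br_xx ltnn rmorph1; ring.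
- by rewrite mul1r.
- move=> l lj; rewrite derIM !derIX !Bweyl /= /br_yy /br_xy.
  move: lj; rewrite -val_eqE; case: (ltngtP l j) => // jl _; rewrite ?mulN1r;
  rewrite !rmorphD ?rmorphN /=; ring.
- rewrite derIM !derIX weyl_anti B_x_y Bweyl /= /br_yy G0 rmorphN rmorph1 mpolyC0; ring.
by rewrite mulN1r.
Qed.

(** For i < j all terms of [Omega i] are scaled by p_j. For i > j the part Omega_j + (q_j - p_j) x_j
    y_j is scaled by q_j: its Omega_j receives p_j from itself and q_j - p_j from the bracket with
    x_j y_j, which explains the coefficients q_l - p_l. *)
Lemma weyl_action_Omega j (t : I) (sg : k) i :
  t = emb (inl j) /\ sg = 1 \/ t = emb (inr j) /\ sg = -1 -> i != j ->
  derI (B t) (Omega i) = (sg * (if (j < i)%N then Q j else P j))%:MP * X t * Omega i.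
Proof.
move=> /weyl_action [Dl Dj DE] ij.
have Dsum (T : pred 'I_n) (c : k) :
    (forall l, T l -> (l != j) && ((if (j < l)%N then Q j else P j) == c)) ->
    derI (B t) (\sum_(l < n | T l) (Q l - P l)%:MP * xx l * yy l) =
    (sg * c)%:MP * X t * (\sum_(l < n | T l) (Q l - P l)%:MP * xx l * yy l).
  move=> H; rewrite /derI der_sum mulr_sumr; apply: eq_bigr => l /H /andP [lj /eqP <-].
  by rewrite -mulrA -/(derI (B t) _) derICM Dl //; ring.
have below (m : 'I_n) : (m <= j)%N ->
    derI (B t) (Omega m) = (sg * P j)%:MP * X t * Omega m.
  move=> mj; rewrite /Omega derID DE (Dsum _ (P j)) -?mulrDr //.
  move=> l lm; have lj := leq_trans lm mj.
  by rewrite -val_eqE /= (ltn_eqF lj) ltnNge (ltnW lj) eqxx.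
case: (ltnP j i) => [ji|]; last exact: below.
pose R := \sum_(l < n | (j < l < i)%N) (Q l - P l)%:MP * xx l * yy l.
have OE : Omega i = Omega j + (Q j - P j)%:MP * (xx j * yy j) + R.
  rewrite /Omega (bigD1 j) //= (bigID (fun l : 'I_n => (l < j)%N)) /=.
  have -> : \sum_(l < n | (l < i)%N && (l != j) && (l < j)%N) (Q l - P l)%:MP * xx l * yy l
      = \sum_(l < n | (l < j)%N) (Q l - P l)%:MP * xx l * yy l.
    apply: eq_bigl => l; case: (ltnP l j) => lj; rewrite ?andbF // andbT.
    by rewrite (ltn_trans lj ji) -val_eqE /= (ltn_eqF lj).
  have -> : \sum_(l < n | (l < i)%N && (l != j) && ~~ (l < j)%N) (Q l - P l)%:MP * xx l * yy l = R.
    by apply: eq_bigl => l; rewrite -val_eqE /=; case: (ltngtP j l); rewrite ?andbF ?andbT.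
  by ring.
have DR : derI (B t) R = (sg * Q j)%:MP * X t * R.
  by apply: Dsum => l /andP [jl _]; rewrite jl -val_eqE (gtn_eqF jl) eqxx.
rewrite OE derID (derID _ (Omega j)) derICM Dj DR below //.
by rewrite !rmorphM !rmorphB /=; ring.
Qed.

Lemma weyl_jacobi u v t : derI (B u) (B v t) + derI (B v) (B t u) + derI (B t) (B u v) = 0.
Proof.
pose J u v t := derI (B u) (B v t) + derI (B v) (B t u) + derI (B t) (B u v).
have Jc a b c : J a b c = J b c a by rewrite /J; ring.
have Js a b c : J b a c = - J a b c.
  rewrite /J (weyl_anti a c) (weyl_anti c b) (weyl_anti b a) !derIN; ring.
have Jpair i c : J (emb (inl i)) (emb (inr i)) c = 0.
  (* If [c] is x_i or y_i again, the Jacobiator vanishes by antisymmetry alone. *)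
  case: (boolP (paired (emb (inr i)) c)) => [|nyc].
    rewrite /paired clE; case: (I_P c) => [j ->|j ->|->] //; rewrite clE // => /eqP ->.
    have Bxx : B (emb (inl j)) (emb (inl j)) = 0 by rewrite Bweyl /= /br_xx ltnn.
    by rewrite /J Bxx derI0 weyl_anti derIN addr0 addNr.
  case: (boolP (paired (emb (inl i)) c)) => [|nxc].
    rewrite /paired clE; case: (I_P c) => [j ->|j ->|->] //; rewrite clE // => /eqP ->.
    have Byy : B (emb (inr j)) (emb (inr j)) = 0.
      by rewrite Bweyl /= /br_yy (anti_diag j k0 GT) mpolyC0 !mul0r.
    rewrite /J Byy derI0 (weyl_anti (emb (inr j)) (emb (inl j))) derIN add0r; ring.
  (* Bracketing with [c] scales x_i by [c2] and y_i by [- c1], each time with a factor [X c];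
     Jacobi's identity then amounts to [Omega i] being scaled by the sum [c2 - c1]. *)
  have DO : exists c1 c2 : k, [/\ B (emb (inr i)) c = c1%:MP * yy i * X c,
      B c (emb (inl i)) = c2%:MP * X c * xx i &
      derI (B c) (Omega i) = (c2 - c1)%:MP * X c * Omega i].
    case: (I_P c) nyc nxc => [j ->|j ->|cz]; rewrite /paired ?clE ?cz.
    - rewrite eq_sym => ij _.
      have DO := weyl_action_Omega (or_introl (conj (erefl (emb (inl j))) (erefl 1))).
      exists (- (if (j < i)%N then P i + G i j else Q i + G i j)).
      exists (if (j < i)%N then Q j - P i + G j i else - (Q i - P j + G i j)).
      rewrite DO 1?eq_sym // !Bweyl /= /br_xy /br_xx (anti_entry i j GT).
      move: ij; rewrite -val_eqE; case: (ltngtP j i) => // ji _;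
        split; rewrite ?rmorphN /=; ring.
    - move=> _ ij.
      have DO := weyl_action_Omega (or_intror (conj (erefl (emb (inr j))) (erefl (-1)))).
      exists (G i j), (- (if (i < j)%N then P j + G j i else Q j + G j i)).
      rewrite DO // !Bweyl /= /br_yy /br_xy (anti_entry i j GT).
      move: ij; rewrite -val_eqE; case: (ltngtP i j) => // ji _;
        split; rewrite ?rmorphN /=; ring.
    move=> _ _; exists (- (P i / 2%:R)), (- (P i / 2%:R)).
    rewrite Bz' // Bz // rmorphN /=; split; [ring | by [] |].
    rewrite subrr mpolyC0 !mul0r /Omega derID.
    have -> : derI (B c) E = 0.
      case: E_cases => [->|[z zN ->]]; first exact: derI0.
      by rewrite -mulrA derICM derIM derIX (z_uniq cz zN) Bzz //; ring.
    rewrite addr0 /derI der_sum big1 // => l _.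
    rewrite -mulrA -/(derI (B c) _) derICM derIM !derIX !Bz // /half_weight rmorphN /=; ring.
  have [c1 [c2 [E1 E2 E3]]] := DO.
  have E1' : B c (emb (inr i)) = - (c1%:MP * yy i * X c) by rewrite weyl_anti E1.
  have E2' : B (emb (inl i)) c = - (c2%:MP * X c * xx i) by rewrite weyl_anti E2.
  rewrite /J E1 E2 B_x_y derID -!mulrA !derICM !derIM !derIX.
  rewrite E1 E2 E1' E2' (weyl_anti (emb (inr i)) (emb (inl i))) B_x_y E3.
  by rewrite rmorphB /=; ring.
have Jpaired a b c : paired a b -> J a b c = 0.
  rewrite /paired; case: (I_P a) => [i ->|i ->|->] //;
    case: (I_P b) => [j ->|j ->|bz]; rewrite ?clE ?bz // => /eqP ->.
    exact: Jpair.
  by rewrite Js Jpair oppr0.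
rewrite -/(J u v t).
case: (boolP (paired u v)) => [|nuv]; first exact: Jpaired.
case: (boolP (paired v t)) => [|nvt]; first by rewrite Jc; exact: Jpaired.
case: (boolP (paired t u)) => [|ntu]; first by rewrite Jc Jc; exact: Jpaired.
have [[c1 E1] [c2 E2] [c3 E3]] := And3 (unpaired_log nuv) (unpaired_log nvt) (unpaired_log ntu).
have E1' : B v u = - (c1%:MP * X u * X v) by rewrite weyl_anti E1.
have E2' : B t v = - (c2%:MP * X v * X t) by rewrite weyl_anti E2.
have E3' : B u t = - (c3%:MP * X t * X u) by rewrite weyl_anti E3.
rewrite /J E1 E2 E3 -!mulrA !derICM !derIM !derIX E1 E2 E3 E1' E2' E3'.
by ring.
Qed.

End Jacobi.

(** The order z, y_1, x_1, y_2, x_2, and so on: everything in [Omega i] comes before x_i, and so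
    does y_i. *)
Definition rank_weyl (u : I) : nat :=
  match cl u with
  | None => 0
  | Some (inr i) => i.*2.+1
  | Some (inl i) => i.*2.+2
  end.

Lemma rank_weyl_inj : injective rank_weyl.
Proof.
move=> u v; rewrite /rank_weyl => uv; apply: clI; move: uv.
case: (cl u) => [[i|i]|]; case: (cl v) => [[j|j]|] //= e.
- by congr (Some (inl _)); apply: ord_inj; case: e => /double_inj.
- by exfalso; lia.
- by exfalso; lia.
by congr (Some (inr _)); apply: ord_inj; case: e => /double_inj.
Qed.

Lemma low_weyl u v : (rank_weyl u < rank_weyl v)%N -> lowI B w_weyl v u =
  match cl v with Some (inl i) => if paired v u then Omega i else 0 | _ => 0 end.
Proof.
rewrite /rank_weyl /lowI /w_weyl /paired.
case: (I_P v) => [i ->|i ->|vz]; case: (I_P u) => [j ->|j ->|uz];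
  rewrite ?clE ?uz ?vz ?Bweyl ?Bz ?Bz' //= => lt.
- have ji : (j < i)%N by lia.
  by rewrite /br_xx ltnNge (ltnW ji) /= ji rmorphN /=; ring.
- have ji : (j <= i)%N by lia.
  move: ji; rewrite /br_xy -val_eqE /= leq_eqVlt; case: (ltngtP i j) => //= [ji _|/val_inj <- _].
    by ring.
  by rewrite (anti_diag i k0 GT) addr0 /Omega; ring.
- by ring.
- have ji : (j < i)%N by lia.
  by rewrite /br_xy ji rmorphN /=; ring.
- by rewrite /br_yy subrr.
by rewrite rmorphN /=; ring.
Qed.

Lemma weyl_indep u v c : (rank_weyl u < rank_weyl v)%N -> (rank_weyl v <= rank_weyl c)%N ->
  mderiv (enum_rank c) (lowI B w_weyl v u) = 0.
Proof.
move=> uv vc; rewrite low_weyl //.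
case: (I_P v) vc {uv} => [i ->|i ->|vz]; rewrite ?clE ?vz ?mderiv0 // => vc.
case: ifP => _; last exact: mderiv0.
have free t : (rank_weyl t < rank_weyl (emb (inl i)))%N -> mderiv (enum_rank c) (X t) = 0.
  by move=> lt; rewrite mderivXg; case: eqP => // ct; move: vc; rewrite ct leqNgt lt.
have freeM (a : k) t t' : mderiv (enum_rank c) (X t) = 0 -> mderiv (enum_rank c) (X t') = 0 ->
    mderiv (enum_rank c) (a%:MP * X t * X t') = 0.
  by move=> H1 H2; rewrite !mderivM mderivC H1 H2; ring.
rewrite /Omega mderivD raddf_sum big1 ?add0r => [|l li] /=.
  case: E_cases => [->|[z zN ->]]; first exact: mderiv0.
  by apply: freeM; apply: free; rewrite /rank_weyl zN clE.
by apply: freeM; apply: free; rewrite /rank_weyl !clE; lia.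
Qed.

(** Only x_i has a nonzero delta, and it moves y_i alone; the value [Omega i] involves z and the
    pairs below i, all of them killed. *)
Lemma weyl_nil u v : (rank_weyl u < rank_weyl v)%N ->
  locally_nilpotent_at (deltaI B rank_weyl w_weyl v) (X u).
Proof.
move=> uv; pose nil := locally_nilpotent_at (deltaI B rank_weyl w_weyl v).
have n0 : nil 0 by exists 0%N.
have unpaired_nil t : ~~ paired v t -> nil (X t).
  move=> vt; apply: nil_zero; rewrite derIX; case: ifP => // tv.
  by rewrite low_weyl // (negPf vt); case: (cl v) => [[i|i]|].
case: (boolP (paired v u)) => [vu|]; last exact: unpaired_nil.
apply: nil_step; rewrite derIX uv low_weyl // vu.
case: (I_P v) vu @nil n0 unpaired_nil {uv} => [i ->|i ->|vz]; rewrite ?clE ?vz //.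
move=> _ nil n0 un.
have nM (a : k) t t' : nil (X t) -> nil (X t') -> nil (a%:MP * X t * X t').
  by move=> nt nt'; apply: nilM => //; apply: nilM => //; apply: nilC.
rewrite /Omega; apply: nilD.
  apply: (big_ind nil) => // [x y|l li]; first exact: nilD.
  by apply: nM; apply: un; rewrite /paired !clE // -val_eqE /= gtn_eqF.
case: E_cases => [->|[z zN ->]] //.
by apply: nM; apply: un; rewrite /paired clE zN.
Qed.

Lemma weyl_ore : exists r w, poisson_ore (liftB B) r w.
Proof.
do 2 eexists; apply: (@poisson_ore_indexed _ _ B rank_weyl w_weyl).
- exact: rank_weyl_inj.
- exact: weyl_anti.
- exact: weyl_jacobi.
- exact: weyl_weight.
- exact: weyl_indep.
- exact: weyl_nil.
move=> v; case: (I_P v) => [i ->|i ->|vz].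
(* The shift for x_i is p_i - q_i, nonzero by assumption. *)
- left; rewrite /w_weyl clE (anti_diag i k0 GT) addr0 opprB subr_eq0.
  exact: PQ.
- by right=> u uv; rewrite low_weyl // clE.
by right=> u uv; rewrite low_weyl // vz.
Qed.

End WeylOre.

Lemma ore_weyl_iii (k : fieldType) n (G : 'M[k]_n) (P Q : 'I_n -> k) :
  [pchar k] =i pred0 -> G^T = - G -> (forall i, P i != Q i) ->
  exists r w, poisson_ore (liftB (B_iii G P Q)) r w.
Proof.
move=> k0 GT PQ.
apply: (@weyl_ore k n G P Q _ Some id 0 0 (B_iii G P Q) k0 GT PQ) => //.
- by move=> a b [].
- by left.
Qed.

Lemma ore_weyl_iv (k : fieldType) n (G : 'M[k]_n) (P Q : 'I_n -> k) lam :
  [pchar k] =i pred0 -> G^T = - G -> (forall i, P i != Q i) ->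
  exists r w, poisson_ore (liftB (B_iv G P Q lam)) r w.
Proof.
move=> k0 GT PQ.
pose z := Xg k (None : option ('I_n + 'I_n)).
apply: (@weyl_ore k n G P Q _ id Some lam (lam%:MP * z * z) (B_iv G P Q lam) k0 GT PQ) => //.
- by right; exists None.
- by move=> [a|a] [b|b].
- by move=> _ [i|i] -> //=; rewrite rmorphN.
- by move=> _ [i|i] -> //=; rewrite rmorphN !mulNr opprK.
by move=> _ ->.
Qed.

Theorem theorem4p1 (k : fieldType) (N : nat)
    (B : 'I_N -> 'I_N -> {mpoly k[N]}) (P : prime_idealr {mpoly k[N]}) :
  [pchar k] =i pred0 ->
  poisson_example B ->
  poisson_ideal (pbr B) P ->
  (exists (K : fieldType) (iota : {rmorphism k -> K}) (m : nat) (mu : 'M[k]_m),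
     mu^T = - mu /\
     exists f : {fraction {ideal_quot P}} -> {fraction {mpoly K[m]}},
       poisson_kiso (frac_quot_emb P) (fun c => ((iota c)%:MP)%:F)
         (fbr (@qbr _ P (pbr B))) (qtorus_br iota mu) f)
  /\
  ((forall a, (a \in P) = (a == 0)) ->
   exists mu : 'M[k]_N,
     mu^T = - mu /\
     exists f : {fraction {ideal_quot P}} -> {fraction {mpoly k[N]}},
       poisson_kiso (frac_quot_emb P) (fun c => (c%:MP)%:F)
         (fbr (@qbr _ P (pbr B))) (qtorus_br id mu) f).
Proof.
move=> k0 BP PP.
have [r [w oreP]] : exists r w, poisson_ore B r w; last first.
  exact: ore_fraction_rational k0 oreP PP.
move: {P PP} BP => [n q qT|n p lam pT|n G P Q GT PQ|n G P Q lam GT PQ|n|n].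
- exact: ore_affine_space.
- exact: ore_quantum_matrices.
- exact: ore_weyl_iii.
- exact: ore_weyl_iv.
- exact: ore_symmetric_matrices.
- exact: ore_antisymmetric_matrices.
Qed.
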